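(* Let $Y_{\Delta^*}\subset X_{\Delta^*}=\mathrm{Proj}(\mathbb C[\sigma^\vee\cap(N\oplus\mathbb Z)])$ be an ample Calabi-Yau hypersurface given by the equation $$\sum_{n\in\Delta^*\cap N}a_n\chi^{(n,1)}=0,$$ where $a_n\in\mathbb C$. Then the image of $Y_{\Delta^*}$ by the embedding $$X_{\Delta^*}\hookrightarrow X_{(\tilde\Delta_0\uplus\cdots\uplus\tilde\Delta_k)^*}=\mathrm{Proj}(\mathbb C[\bar\sigma^\vee\cap\bar N])$$ is a nef Calabi-Yau complete intersection given by the equations $$a_0\chi^{r_0^*}+\sum_{n\in(\Delta^*\cap N)\setminus\{0\}}a_n\chi^{\,n-\sum_{j=0}^k\min\langle\Delta_j,n\rangle r_j^*}=0,\qquad \chi^{r_i^*}-\chi^{r_0^*}=0,\quad i=1,\dots,k.$$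
   Context: $M$ and $N$ are dual lattices of finite rank; $M_{\mathbb R},N_{\mathbb R}$ their real extensions. A lattice polytope $\Delta\subset M_{\mathbb R}$ is reflexive if $0$ is in its interior and $\Delta^*=\{n\in N_{\mathbb R}\mid\langle m,n\rangle\ge-1\ \forall m\in\Delta\}$ is a lattice polytope. Throughout, $\Delta$ is a reflexive polytope in $M_{\mathbb R}$ and $\Delta=\Delta_0+\Delta_1+\cdots+\Delta_k$ is a Minkowski sum decomposition by lattice polytopes. For $u\in N_{\mathbb R}$, $\min\langle\Delta_j,u\rangle=\min_{x\in\Delta_j}\langle x,u\rangle$. Cones: $\sigma=\{(t\Delta,t)\mid t\ge0\}\subset M_{\mathbb R}\oplus\mathbb R$, and $\bar\sigma=\{(\sum_{i=0}^k t_i\Delta_i,t_0,\dots,t_k)\mid t_i\ge0\}\subset M_{\mathbb R}\oplus\mathbb R^{k+1}$ (the Cayley cone); $\bar M=M\oplus\mathbb Z^{k+1}$, $\bar N=N\oplus\mathbb Z^{k+1}$; $\{r_0^*,\dots,r_k^*\}$ is the standard basis of $\mathbb Z^{k+1}\subset\bar N$. For a cone $\tau$, $\tau^\vee=\{n\mid\langle m,n\rangle\ge0\ \forall m\in\tau\}$ is the dual cone. $\chi^v$ denotes the element of a semigroup ring corresponding to the lattice point $v$. The ring $\mathbb C[\sigma^\vee\cap(N\oplus\mathbb Z)]$ is graded by the last coordinate, and $\mathbb C[\bar\sigma^\vee\cap\bar N]$ is graded by $\deg\chi^{(n,\alpha_0,\dots,\alpha_k)}=\alpha_0+\cdots+\alpha_k$.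 $X_P$ denotes the toric variety of the normal fan of a polytope $P$. $X_{\Delta^*}$ is the Gorenstein Fano toric variety whose fan in $M_{\mathbb R}$ consists of the cones over the proper faces of $\Delta$. With $\{e_1,\dots,e_k\}$ the standard basis of $\mathbb Z^k\subset M\oplus\mathbb Z^k$ and $e_0=-\sum_{i=1}^ke_i$, set $\tilde\Delta_i=\mathrm{Conv}((\Delta_i+e_i)\cup\{0\})$, and $P\uplus Q=\mathrm{Conv}(P\cup Q)$; the polytope $\tilde\Delta_0\uplus\cdots\uplus\tilde\Delta_k$ is reflexive and $X_{(\tilde\Delta_0\uplus\cdots\uplus\tilde\Delta_k)^*}$ is the Gorenstein Fano toric variety whose fan consists of the cones over its proper faces; it is identified with $\mathrm{Proj}(\mathbb C[\bar\sigma^\vee\cap\bar N])$. The embedding is the one induced by the (known to be surjective) graded ring homomorphism $\mathbb C[\bar\sigma^\vee\cap\bar N]\to\mathbb C[\sigma^\vee\cap(N\oplus\mathbb Z)]$ coming from $\bar N\to N\oplus\mathbb Z$, $(n,\alpha_0,\dots,\alpha_k)\mapsto(n,\alpha_0+\cdots+\alpha_k)$. An ample Calabi-Yau hypersurface in a Gorenstein Fano toric variety is a hypersurface of anticanonical degree. A nef Calabi-Yau complete intersection is a complete intersection of hypersurfaces of nef degrees whose sum is the anticanonical degree. *)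

(* Defs.v *)
From HB Require Import structures.
From mathcomp Require Import all_boot all_order all_algebra.
From mathcomp Require Import finmap.
From mathcomp Require Import boolp classical_sets functions cardinality fsbigop.
From mathcomp Require Import reals topology normedtype.
From mathcomp Require Import complex.
From mathcomp.multinomials Require Import -(notations) monalg.

Set Implicit Arguments.
Unset Strict Implicit.
Unset Printing Implicit Defensive.

Import Order.TTheory GRing.Theory Num.Theory.
Import numFieldNormedType.Exports.

Local Open Scope classical_set_scope.
Local Open Scope ring_scope.

(* [sgring K G] is the semigroup ring K[G] of a commutative monoid G, written
   additively; << u >> is chi^u. *)

Notation "f @_ u" := (mcoeff u f)
  (at level 3, u at level 2, left associativity, format "f @_ u") : ring_scope.
Notation "<< u >>" := (mkmalgU u 1) (format "<< u >>") : ring_scope.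

Section SemigroupRing.
Variables (K : comNzRingType) (G : nmodType).

Definition sgring : Type := malg G K.

HB.instance Definition _ := GRing.Lmodule.on sgring.

Definition linext (V : lmodType K) (h : G -> V) (f : sgring) : V :=
  \sum_(u <- msupp f) f@_u *: h u.

Lemma linextE (V : lmodType K) (h : G -> V) (f : sgring) (S : {fset G}) :
  (msupp f `<=` S)%fset -> linext h f = \sum_(u <- S) f@_u *: h u.
Proof.
move=> sub; rewrite /linext (big_fset_incl _ sub) // => u _ uS.
by rewrite mcoeff_outdom // scale0r.
Qed.

Lemma linext_is_linear (V : lmodType K) (h : G -> V) : linear (linext h).
Proof.
move=> c f g; pose S := (msupp f `|` msupp g)%fset.
have sf : (msupp f `<=` S)%fset by exact: fsubsetUl.
have sg : (msupp g `<=` S)%fset by exact: fsubsetUr.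
have sfg : (msupp (c *: f + g : sgring) `<=` S)%fset.
  apply: fsubset_trans (msuppD_le _ _) _.
  by apply: fsetUSS => //; exact: msuppZ_le.
rewrite (linextE _ sf) (linextE _ sg) (linextE _ sfg) scaler_sumr -big_split /=.
apply: eq_bigr => u _.
by rewrite mcoeffD mcoeffZ scalerDl scalerA.
Qed.

HB.instance Definition _ (V : lmodType K) (h : G -> V) :=
  GRing.isLinear.Build K sgring V *:%R (linext h) (linext_is_linear h).

Lemma linextU (V : lmodType K) (h : G -> V) (u : G) :
  linext h (<< u >> : sgring) = h u.
Proof.
rewrite (@linextE V h _ [fset u]%fset); last exact: msuppU_le.
by rewrite big_seq_fset1 mcoeffUU scale1r.
Qed.

Lemma linext_eq (V : lmodType K) (F H : sgring -> V) : linear F -> linear H ->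
  (forall u, F (<< u >> : sgring) = H (<< u >> : sgring)) -> F =1 H.
Proof.
move=> linF linH eFH f.
pose F' : {linear sgring -> V} := HB.pack F
  (GRing.isLinear.Build K sgring V *:%R F linF).
pose H' : {linear sgring -> V} := HB.pack H
  (GRing.isLinear.Build K sgring V *:%R H linH).
rewrite -[F f]/(F' f) -[H f]/(H' f).
have -> : f = \sum_(u <- msupp f) f@_u *: (<< u >> : sgring).
  rewrite {1}[f]monalgE; apply: eq_bigr => u _; apply/malgP => v.
  by rewrite mcoeffZ !mcoeffU mulr_natr.
by rewrite !linear_sum; apply: eq_bigr => u _; rewrite !linearZ /= eFH.
Qed.

Definition sgmul (f g : sgring) : sgring :=
  linext (fun u => linext (fun v => (<< u + v >> : sgring)) g) f.

Lemma sgmul_linl g : linear (sgmul^~ g).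
Proof. by move=> c f1 f2; rewrite /sgmul linearP. Qed.

Lemma sgmul_linr f : linear (sgmul f).
Proof.
move=> c g1 g2; rewrite /sgmul /linext scaler_sumr -big_split /=.
apply: eq_bigr => u _.
rewrite -!/(linext _ _) linearP scalerDr !scalerA; congr (_ + _).
by rewrite mulrC.
Qed.

Lemma sgmulU u v :
  sgmul (<< u >> : sgring) (<< v >> : sgring) = (<< u + v >> : sgring).
Proof. by rewrite /sgmul !linextU. Qed.

Definition sgone : sgring := << 0 >>.

Fact sgmulC : commutative sgmul.
Proof.
move=> f g; apply: (linext_eq (sgmul_linl g) (sgmul_linr g)) => u.
apply: (linext_eq (sgmul_linr _) (sgmul_linl _)) => v.
by rewrite !sgmulU addrC.
Qed.

Fact sgmul1 : left_id sgone sgmul.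
Proof.
apply: (linext_eq (sgmul_linr _)) => [c f g //|u].
by rewrite sgmulU add0r.
Qed.

Fact sgmulDl : left_distributive sgmul +%R.
Proof. by move=> f g h; have := sgmul_linl h 1 f g; rewrite !scale1r. Qed.

Fact sgmulA : associative sgmul.
Proof.
have L g := sgmul_linl g; have Rr f := sgmul_linr f.
have comp F H : linear F -> linear H -> linear (F \o H : sgring -> sgring).
  by move=> lF lH c x y /=; rewrite lH lF.
move=> f g h.
apply: (linext_eq (F := sgmul^~ (sgmul g h))
                  (H := sgmul^~ h \o sgmul^~ g) _ _ _ f) => [||u] //=.
  exact: comp.
apply: (linext_eq (F := sgmul << u >> \o sgmul^~ h)
                  (H := sgmul^~ h \o sgmul << u >>) _ _ _ g) => [||v] /=.
- exact: comp.
- exact: comp.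
apply: (linext_eq (F := sgmul << u >> \o sgmul << v >>)
                  (H := sgmul (sgmul << u >> << v >>)) _ _ _ h) => [||w] //=.
  exact: comp.
by rewrite !sgmulU addrA.
Qed.

Fact sgone_neq0 : sgone != 0 :> sgring.
Proof. by rewrite monalgU_eq0 oner_neq0. Qed.

HB.instance Definition _ := GRing.Zmodule_isComNzRing.Build sgring
  sgmulA sgmulC sgmul1 sgmulDl sgone_neq0.

End SemigroupRing.

Definition sgmap (K : comNzRingType) (G H : nmodType) (h : G -> H) :
    sgring K G -> sgring K H :=
  linext (fun u => (<< h u >> : sgring K H)).

Section Proj.
Variables (A : comNzRingType) (gr : int -> set A).

Definition ideal_of n (F : 'I_n -> A) : set A :=
  [set x | exists c : 'I_n -> A, x = \sum_i c i * F i].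

Definition homogeneous (I : {pred A}) : Prop :=
  forall x, x \in I -> exists s : seq A,
    (forall y, y \in s -> y \in I /\ exists e, gr e y) /\ x = \sum_(y <- s) y.

(* [idealr_closed] includes that p is proper; the last condition says that p
   does not contain the irrelevant ideal. *)
Definition in_Proj (p : {pred A}) : Prop :=
  [/\ idealr_closed p, prime_idealr_closed p, homogeneous p
    & exists e x, [/\ 0 < e, gr e x & x \notin p]].

Definition in_Vplus (I : set A) (p : {pred A}) : Prop :=
  in_Proj p /\ forall x, I x -> x \in p.

(* For g homogeneous of positive degree e and b homogeneous of degree r e, the
   function b / g ^ r on D_+(g) is a section of the ideal sheaf of V_+(I). *)
Definition in_ideal_sheaf (I : set A) (g b : A) : Prop :=
  exists s : nat, I (g ^+ s * b).

(* The complete intersections below are those cut out by a regular sequence of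
   homogeneous elements of the coordinate ring. *)
Definition regular_sequence n (F : 'I_n -> A) : Prop :=
  (forall (i : 'I_n) (x : A),
     let I := [set y | exists c : 'I_n -> A,
                 y = \sum_(j < n | (j < i)%N) c j * F j] in
     I (F i * x) -> I x)
  /\ ~ ideal_of F 1.

End Proj.

(* The closed subscheme V_+(J) of Proj B is the image of the closed subscheme
   V_+(I) of Proj A by the morphism Proj A -> Proj B induced by phi : B -> A:
   the points of V_+(J) are the images of those of V_+(I), and the ideal sheaf
   of V_+(J) is the kernel of the map from O_(Proj B) to the direct image of
   the structure sheaf of V_+(I). *)
Definition is_image (A B : comNzRingType) (grA : int -> set A)
    (grB : int -> set B) (phi : B -> A) (I : set A) (J : set B) : Prop :=
  (forall p : {pred B},
     in_Vplus grB J p <->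
     exists q : {pred A}, in_Vplus grA I q /\ p =i [preim phi of q])
  /\ (forall (e : int) (r : nat) (g b : B),
        0 < e -> grB e g -> grB (e *+ r) b ->
        (in_ideal_sheaf J g b <-> in_ideal_sheaf I (phi g) (phi b))).

(* The lattices M and N are both Z^d, paired by the standard dot product. *)
Definition dotp (K : pzRingType) (m : nat) (x y : 'rV[K]_m) : K :=
  (x *m y^T) 0 0.

Section Polytopes.
Variables (R : realType) (m : nat).
Implicit Types (A F : set 'rV[R]_m).

Definition realv (v : 'rV[int]_m) : 'rV[R]_m := map_mx intr v.

Definition conv A : set 'rV[R]_m :=
  [set x | exists (n : nat) (c : 'I_n -> R) (p : 'I_n -> 'rV[R]_m),
    [/\ forall i, 0 <= c i, \sum_i c i = 1, forall i, A (p i)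
      & x = \sum_i c i *: p i]].

Definition lattice_polytope A : Prop :=
  exists s : seq 'rV[int]_m, A = conv [set realv v | v in [set` s]].

Definition polar A : set 'rV[R]_m :=
  [set n | forall x, A x -> -1 <= dotp x n].

Definition reflexive_polytope A : Prop :=
  [/\ lattice_polytope A, A^° 0 & lattice_polytope (polar A)].

Definition minkowski_sum k (A_ : 'I_k.+1 -> set 'rV[R]_m) : set 'rV[R]_m :=
  [set x | exists y : 'I_k.+1 -> 'rV[R]_m,
    (forall i, A_ i (y i)) /\ x = \sum_i y i].

Definition proper_face A F : Prop :=
  F <> A /\ exists (u : 'rV[R]_m) (c : R),
    (forall x, A x -> c <= dotp x u) /\ F = [set x | A x /\ dotp x u = c].

Definition vertex A (x : 'rV[R]_m) : Prop := proper_face A [set x].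

Definition dual_cone A : set 'rV[R]_m :=
  [set n | forall x, A x -> 0 <= dotp x n].

(* min_(x in A) <x, n> for a lattice polytope A and a lattice vector n: it is
   attained at a lattice point, so it is an integer and [floor] is exact. *)
Definition min_pairing A (n : 'rV[int]_m) : int :=
  Num.floor (inf [set dotp x (realv n) | x in A]).

Definition lattice_points A : set 'rV[int]_m := [set v | A (realv v)].

(* Divisors on the toric variety whose fan consists of the cones over the
   proper faces of a reflexive polytope Q: the rays are generated by the
   vertices of Q, and a torus-invariant Weil divisor assigns an integer to
   each of them; only the values at the vertices of Q matter. *)

Variable Q : set 'rV[R]_m.

Definition tdivisor := 'rV[int]_m -> int.

Definition lin_equiv (D E : tdivisor) : Prop :=
  exists u : 'rV[int]_m, forall v, vertex Q (realv v) -> D v - E v = dotp v u.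

Definition anticanonical : tdivisor := fun=> 1.

(* D is nef: it is Cartier, and its support function psi (integral linear on
   each cone of the fan) is concave. *)
Definition nef (D : tdivisor) : Prop :=
  exists psi : 'rV[R]_m -> R,
    [/\ forall v, vertex Q (realv v) -> psi (realv v) = - (D v)%:~R,
        forall F, proper_face Q F -> exists u : 'rV[int]_m,
          forall t x, 0 <= t -> F x -> psi (t *: x) = dotp (t *: x) (realv u)
      & forall x y, psi x + psi y <= psi (x + y)].

End Polytopes.

Section ConeSemigroup.
Variables (R : realType) (m : nat) (tau : set 'rV[R]_m).

Definition in_dual : {pred 'rV[int]_m} :=
  fun w => `[< dual_cone tau (realv R w) >].

Fact in_dual_addr_closed : addr_closed in_dual.
Proof.
split.
  by apply/asboolP => x _; rewrite /dotp /realv map_mx0 trmx0 mulmx0 mxE.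
move=> u v /asboolP hu /asboolP hv; apply/asboolP => x tx.
rewrite /dotp /realv map_mxD linearD /= mulmxDr mxE.
by apply: addr_ge0; [exact: hu | exact: hv].
Qed.
HB.instance Definition _ :=
  GRing.isAddClosed.Build 'rV[int]_m in_dual in_dual_addr_closed.

Record dual_semigroup := DualSemigroup {
  lattice_pt :> 'rV[int]_m;
  _ : in_dual lattice_pt }.
HB.instance Definition _ := [isSub for lattice_pt].
HB.instance Definition _ := [Choice of dual_semigroup by <:].
HB.instance Definition _ := GRing.SubChoice_isSubNmodule.Build
  'rV[int]_m in_dual dual_semigroup in_dual_addr_closed.

Definition cone_ring := sgring R[i] dual_semigroup.
HB.instance Definition _ := GRing.ComNzRing.on cone_ring.
HB.instance Definition _ := GRing.Lmodule.on cone_ring.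

(* The monomial chi^w; by convention 0 if w is not in the semigroup. *)
Definition chi (w : 'rV[int]_m) : cone_ring :=
  if insub w is Some u then << (u : dual_semigroup) >> else 0.

End ConeSemigroup.

Definition ldeg (d l : nat) (w : 'rV[int]_(d + l)) : int :=
  \sum_(j < l) w 0 (rshift d j).

Definition cone_gr (R : realType) (d l : nat) (tau : set 'rV[R]_(d + l))
    (e : int) : set (cone_ring tau) :=
  [set f | forall w, w \in msupp f -> ldeg (lattice_pt w) = e].

(* Proj of [cone_ring tau] is the toric
   variety whose fan consists of the cones over the proper faces of Q, and
   [lift v] is the primitive generator of the ray of tau corresponding to the
   ray through the vertex v.  The divisor of zeros of the section chi^w is
   \sum_v <lift v, w> D_v, and a hypersurface F = 0 is linearly equivalent to
   the divisor of zeros of any monomial of F. *)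

Section Hypersurfaces.
Variables (R : realType) (d l m : nat) (tau : set 'rV[R]_(d + l)).
Variables (Q : set 'rV[R]_m) (lift : 'rV[int]_m -> 'rV[int]_(d + l)).

Definition hypersurface_of_degree (F : cone_ring tau) (D : tdivisor m) : Prop :=
  [/\ F != 0, exists e : int, cone_gr e F
    & forall w, w \in msupp F ->
        lin_equiv Q (fun v => dotp (lift v) (lattice_pt w)) D].

Definition CY_hypersurface (F : cone_ring tau) : Prop :=
  hypersurface_of_degree F (@anticanonical m).

Definition nef_CY_complete_intersection n (F : 'I_n -> cone_ring tau) : Prop :=
  regular_sequence F /\
  exists D : 'I_n -> tdivisor m,
    (forall i, hypersurface_of_degree (F i) (D i) /\ nef Q (D i)) /\
    lin_equiv Q (fun v => \sum_i D i v) (@anticanonical m).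

End Hypersurfaces.

Section Cayley.
Variables (R : realType) (d k : nat).

Definition sigma (Delta : set 'rV[R]_d) : set 'rV[R]_(d + 1) :=
  [set z | exists t x, [/\ 0 <= t, Delta x & z = row_mx (t *: x) (const_mx t)]].

Variable Delta_ : 'I_k.+1 -> set 'rV[R]_d.

Definition sigma_bar : set 'rV[R]_(d + k.+1) :=
  [set z | exists (t : 'rV[R]_k.+1) (x : 'I_k.+1 -> 'rV[R]_d),
    [/\ forall i, 0 <= t 0 i, forall i, Delta_ i (x i)
      & z = row_mx (\sum_i t 0 i *: x i) t]].

Definition sum_last (w : 'rV[int]_(d + k.+1)) : 'rV[int]_(d + 1) :=
  row_mx (lsubmx w) (const_mx (ldeg w)).

Fact sum_last_dual (w : dual_semigroup sigma_bar) :
  in_dual (sigma (minkowski_sum Delta_)) (sum_last w).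
Proof.
case: w => w /= /asboolP hw; apply/asboolP => z [t [x [t0 [y [hy ->]] ->]]].
have := hw (row_mx (\sum_i t *: y i) (const_mx t)).
have -> : dotp (row_mx (\sum_i t *: y i) (const_mx t)) (realv R w) =
          dotp (row_mx (t *: \sum_i y i) (const_mx t)) (realv R (sum_last w)).
  rewrite /dotp /realv /sum_last map_row_mx -[in LHS](hsubmxK w) map_row_mx.
  rewrite !tr_row_mx !mul_row_col scaler_sumr !mxE; congr (_ + _).
  rewrite big_ord1 !mxE /ldeg rmorph_sum mulr_sumr; apply: eq_bigr => j _.
  by rewrite !mxE.
apply; exists (const_mx t), y; split => // [i|]; first by rewrite mxE.
by congr row_mx; apply: eq_bigr => i _; rewrite mxE.
Qed.

Definition sum_last_semigroup (w : dual_semigroup sigma_bar) :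
    dual_semigroup (sigma (minkowski_sum Delta_)) :=
  DualSemigroup (sum_last_dual w).

(* The homomorphism C[sigma_bar^vee] -> C[sigma^vee] inducing the embedding. *)
Definition restriction :
    cone_ring sigma_bar -> cone_ring (sigma (minkowski_sum Delta_)) :=
  sgmap (K := R[i]) sum_last_semigroup.

(* e_1, ..., e_k is the standard basis and e_0 = - (e_1 + ... + e_k). *)
Definition e_vec (K : pzRingType) (i : 'I_k.+1) : 'rV[K]_k :=
  if unlift ord0 i is Some j then delta_mx 0 j else - \sum_j delta_mx 0 j.

Definition tilde_polytope (i : 'I_k.+1) : set 'rV[R]_(d + k) :=
  conv ([set row_mx x (e_vec R i) | x in Delta_ i] `|` [set 0]).

Definition cayley_polytope : set 'rV[R]_(d + k) :=
  conv (\bigcup_i tilde_polytope i).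

Definition r_vec (j : 'I_k.+1) : 'rV[int]_(d + k.+1) :=
  row_mx 0 (delta_mx 0 j).

Definition sigma_lift (v : 'rV[int]_d) : 'rV[int]_(d + 1) :=
  row_mx v (const_mx 1).

(* The fan of [cayley_polytope] is the image of the boundary of [sigma_bar]
   under (x, t) |-> (x, t_1 - t_0, ..., t_k - t_0), which maps the j-th basis
   vector of Z^(k+1) to e_j.  [sigma_bar_lift] is the section of this projection
   over t_0 + ... + t_k = 1; at the vertices the division is exact, as
   [sigma_bar_liftE] shows. *)
Definition sigma_bar_lift (x : 'rV[int]_(d + k)) : 'rV[int]_(d + k.+1) :=
  let s := ((1 - ldeg x) %/ k.+1%:Z)%Z in
  row_mx (lsubmx x)
    (\row_j (s + if unlift ord0 j is Some i then x 0 (rshift d i) else 0)).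

Lemma sigma_bar_liftE (v : 'rV[int]_d) (j : 'I_k.+1) :
  sigma_bar_lift (row_mx v (e_vec int j)) = row_mx v (delta_mx 0 j).
Proof.
rewrite /sigma_bar_lift row_mxKl /ldeg; congr row_mx; apply/rowP => i.
rewrite !mxE; under eq_bigr do rewrite row_mxEr.
have sumd l : \sum_(a < k) (delta_mx 0 l : 'rV[int]_k) 0 a = 1.
  rewrite (bigD1 l) //= mxE !eqxx big1 ?addr0 // => a /negPf al.
  by rewrite mxE al andbF.
have sumdE a : (\sum_l (delta_mx 0 l : 'rV[int]_k)) 0 a = 1.
  rewrite summxE (bigD1 a) //= mxE !eqxx big1 ?addr0 // => b /negPf ba.
  by rewrite mxE eq_sym ba andbF.
rewrite /e_vec; case: (unliftP ord0 j) => [j'|] ->.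
  rewrite sumd subrr div0z add0r; case: (unliftP ord0 i) => [i'|] -> //.
  by rewrite row_mxEr mxE (inj_eq lift_inj).
have -> : \sum_(a < k) (- \sum_l (delta_mx 0 l : 'rV[int]_k)) 0 a = - k%:Z.
  rewrite (eq_bigr (fun=> -1)) => [|a _]; last by rewrite mxE sumdE.
  by rewrite sumr_const card_ord mulNrn natz.
rewrite opprK -[1]/(1%:Z) -PoszD add1n divzz /=.
case: (unliftP ord0 i) => [i'|] -> //=.
by rewrite row_mxEr mxE sumdE.
Qed.

End Cayley.

Section Equations.
Variables (R : realType) (d k : nat) (Delta_ : 'I_k.+1 -> set 'rV[R]_d).
Variable a : 'rV[int]_d -> R[i].
Let Delta := minkowski_sum Delta_.

Definition hypersurface_eq : cone_ring (sigma Delta) :=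
  \sum_(n \in lattice_points (polar Delta))
     a n *: chi (sigma Delta) (row_mx n (const_mx 1)).

Definition intersection_eq (i : 'I_k.+1) : cone_ring (sigma_bar Delta_) :=
  if i == ord0 then
    a 0 *: chi (sigma_bar Delta_) (r_vec d ord0) +
    \sum_(n \in lattice_points (polar Delta) `\ 0)
       a n *: chi (sigma_bar Delta_)
         (row_mx n 0 - \sum_j min_pairing (Delta_ j) n *: r_vec d j)
  else chi (sigma_bar Delta_) (r_vec d i) - chi (sigma_bar Delta_) (r_vec d ord0).

End Equations.

(* Main.v *)
(* Let x_j = chi^(r_j^* ).  A lattice point (n, alpha) of the dual of the
   Cayley cone is uniquely (n, - min<Delta_j, n>) + sum_j beta_j r_j^* with
   beta_j natural numbers, so the coordinate ring is free over C[x_0, ..., x_k]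
   on the monomials chi^(n, - min<Delta_j, n>), and likewise the coordinate ring
   of X_(Delta^* ) is free over C[x_0] on the images of the same monomials.
   Hence the kernel of the restriction map is generated by the x_j - x_0.
   Identifying only x_0, ..., x_(m-1) gives a homomorphism to a group ring of a
   lattice, which is a domain, with kernel (x_j - x_0, 0 < j < m); comparing
   these kernels for consecutive m shows that the sequence is regular even with
   the first equation put before the differences x_j - x_0.

   Since min<Delta, n> = -1 for every nonzero lattice point n of Delta^*, all the
   equations have degree 1, and every monomial of degree 1 cuts out the same
   divisor class D, with (k + 1) D anticanonical.  The support function of D is
   the concave function x |-> - min {t_0}, over the lifts (x, t) of a point to
   the Cayley cone.  Its integrality on the cone over a face amounts to finding
   a monomial of degree 1 that does not vanish there: if the face misses some
   Delta_j + e_j, take x_j; otherwise the face comes from a proper face of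
   Delta, which by reflexivity lies on a hyperplane <., n> = -1 with n a lattice
   point of Delta^*, and chi^(n, - min<Delta_j, n>) will do. *)
Require Import Defs.
From HB Require Import structures.
From mathcomp Require Import all_boot all_order all_algebra.
From mathcomp Require Import finmap.
From mathcomp Require Import boolp classical_sets functions cardinality fsbigop.
From mathcomp Require Import reals topology normedtype complex.
From mathcomp.multinomials Require Import -(notations) monalg.

From mathcomp Require Import ring.

Set Implicit Arguments.
Unset Strict Implicit.
Unset Printing Implicit Defensive.

Import Order.TTheory GRing.Theory Num.Theory.
Import numFieldNormedType.Exports.

Local Open Scope classical_set_scope.
Local Open Scope ring_scope.

(** * Semigroup rings *)

Section SemigroupRingTheory.
Variables (K : comNzRingType) (G : nmodType).

Lemma sgcoeffZ c (f : sgring K G) v : (c *: f)@_v = c * f@_v.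
Proof. exact: mcoeffZ. Qed.

Lemma mcoeff_linext (H : nmodType) (h : G -> sgring K H) (f : sgring K G) v :
  (linext h f)@_v = \sum_(u <- msupp f) f@_u * (h u)@_v.
Proof.
rewrite /linext raddf_sum; apply: eq_bigr => u _; exact: mcoeffZ.
Qed.

Lemma sgringE (f : sgring K G) :
  f = \sum_(u <- msupp f) f@_u *: (<< u >> : sgring K G).
Proof.
rewrite {1}[f]monalgE; apply: eq_bigr => u _; apply/malgP => v.
by rewrite sgcoeffZ !mcoeffU mulr_natr.
Qed.

Lemma sgcoeffM (f g : sgring K G) w :
  (f * g)@_w =
  \sum_(u <- msupp f) \sum_(v <- msupp g) f@_u * g@_v *+ (u + v == w).
Proof.
rewrite -[f * g]/(sgmul f g) /sgmul mcoeff_linext; apply: eq_bigr => u _.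
rewrite mcoeff_linext mulr_sumr; apply: eq_bigr => v _.
by rewrite mcoeffU mulr_natr mulrnAr.
Qed.

Lemma sgmapU (H : nmodType) (h : G -> H) u :
  sgmap h (<< u >> : sgring K G) = << h u >>.
Proof. exact: linextU. Qed.

Lemma sgmap_is_linear (H : nmodType) (h : G -> H) :
  linear (sgmap h : sgring K G -> sgring K H).
Proof. by move=> c f g; rewrite /sgmap linearP. Qed.

HB.instance Definition _ (H : nmodType) (h : G -> H) :=
  GRing.isLinear.Build K (sgring K G) (sgring K H) *:%R (sgmap h)
    (sgmap_is_linear h).

Lemma mulUU (u v : G) :
  (<< u >> : sgring K G) * (<< v >> : sgring K G) = << u + v >>.
Proof. exact: sgmulU. Qed.

Lemma sgring1E : 1 = << 0 >> :> sgring K G.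
Proof. by []. Qed.

(** Lets a set of elements that is closed under ring multiplication absorb scalars. *)
Lemma sgringZE c (f : sgring K G) :
  c *: f = (c *: (1 : sgring K G) : sgring K G) * f.
Proof.
have := sgmul_linl f c 1 0; rewrite !addr0 => e.
by rewrite -[RHS]/(sgmul _ _) e -[sgmul 1 f]/(1 * f) -[sgmul 0 f]/(0 * f)
  mul1r mul0r addr0.
Qed.

Lemma expU (u : G) n : (<< u >> : sgring K G) ^+ n = << u *+ n >>.
Proof.
elim: n => [|n IH]; first by rewrite expr0 mulr0n.
by rewrite exprS IH mulUU mulrS.
Qed.

Lemma prodU (I : finType) (u : I -> G) :
  << \sum_i u i >> = \prod_i (<< u i >> : sgring K G).
Proof.
by elim/big_ind2: _ => // x1 x2 y1 y2 <- <-; rewrite mulUU.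
Qed.

End SemigroupRingTheory.

Section SgmapMorphism.
Variables (K : comNzRingType) (G H : nmodType) (h : G -> H).
Hypotheses (h0 : h 0 = 0) (hD : {morph h : x y / x + y}).

(** Both sides are bilinear, so it suffices to compare them on monomials. *)
Lemma sgmapM : {morph (sgmap h : sgring K G -> sgring K H) : f g / f * g}.
Proof.
move=> f g; have L := @sgmul_linl; have Rr := @sgmul_linr.
have linl (x : sgring K G) :
    linear (fun f : sgring K G => sgmap h (f * x) : sgring K H).
  by move=> c y z; rewrite -[_ * x]/(sgmul _ x) L linearP.
have linl' (x : sgring K H) : linear (fun f : sgring K G => sgmap h f * x).
  by move=> c y z; rewrite linearP -[_ * x]/(sgmul _ x) L.
apply: (linext_eq (linl g) (linl' (sgmap h g))) => u.
pose U : sgring K G := << u >>.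
have linr : linear (fun g : sgring K G => sgmap h (U * g) : sgring K H).
  by move=> c y z; rewrite -[U * _]/(sgmul U _) Rr linearP.
have linr' : linear (fun g : sgring K G => sgmap h U * sgmap h g).
  by move=> c y z; rewrite linearP -[sgmap h U * _]/(sgmul (sgmap h U) _) Rr.
apply: (linext_eq linr linr') => v.
by rewrite /U mulUU !sgmapU mulUU hD.
Qed.

Lemma sgmap1 : sgmap h (1 : sgring K G) = 1 :> sgring K H.
Proof. by rewrite sgring1E sgmapU h0. Qed.

End SgmapMorphism.

(* Fix a section s of h on its image; modulo L, f is congruent to the image of
   sgmap h f = 0 under the linear extension of chi^u |-> chi^(s u). *)
Lemma sgmap_kernel (K : comNzRingType) (G H : nmodType) (h : G -> H)
    (L : set (sgring K G)) :
  L 0 -> (forall x y, L x -> L y -> L (x + y)) ->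
  (forall x y, L y -> L (x * y)) ->
  (forall u v, h u = h v -> L (<< u >> - << v >>)) ->
  forall f : sgring K G, sgmap h f = 0 :> sgring K H -> L f.
Proof.
move=> L0 LD LM Lh f f0.
have /choice [s hs] : forall u : H, exists v : G,
    (exists w, h w = u) -> h v = u.
  move=> u; have [[w hw]|nh] := pselect (exists w, h w = u).
    by exists w.
  by exists 0 => hw; case: nh.
have e : linext (fun u => (<< s u >> : sgring K G)) (sgmap h f) =
         \sum_(u <- msupp f) f@_u *: (<< s (h u) >> : sgring K G).
  rewrite {1}[f]sgringE (linear_sum (sgmap h)) (linear_sum (linext _)).
  apply: eq_bigr => u _.
  by rewrite !linearZ /= sgmapU linextU.
rewrite f0 linear0 in e.
rewrite -[f]subr0 e {1}[f]sgringE -sumrB.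
elim/big_ind: _ => // u _; rewrite -scalerBr sgringZE; apply: LM.
by apply: Lh; rewrite hs //; exists u.
Qed.

(* Evaluate the polynomials attached to the vectors at an integer that is a
   root of none of them. *)
Lemma separating_functional m (s : seq 'rV[int]_m) :
  exists h : 'rV[int]_m -> int, {morph h : x y / x - y} /\
    forall u, u \in s -> h u = 0 -> u = 0.
Proof.
pose p : {poly int} := \prod_(u <- s | u != 0) rVpoly u.
have p0 : p != 0.
  rewrite prodf_seq_neq0; apply/allP => u _; apply/implyP; apply: contra.
  by move=> /eqP u0; rewrite -[u]rVpolyK u0 linear0.
have [t pt] : exists t, ~~ root p t.
  apply: contrapT => /forallNP nr.
  have := max_poly_roots (rs := [seq (Posz i) | i <- iota 0 (size p)]) p0.
  rewrite size_map size_iota ltnn => max_roots.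
  suff: false by []; apply: max_roots.
    by apply/allP => _ /mapP[i _ ->]; apply/negPn/negP/nr.
  by rewrite map_inj_uniq ?iota_uniq // => i j [].
exists (fun u => (rVpoly u).[t]); split=> [x y|u us hu].
  by rewrite linearB /= hornerD hornerN.
apply: contrapT => /eqP u0; move: pt; rewrite /root /p horner_prod.
by rewrite prodf_seq_neq0 => /allP /(_ _ us); rewrite u0 hu eqxx.
Qed.

Lemma int_argmax (T : eqType) (s : seq T) (h : T -> int) : s != [::] ->
  exists2 u, u \in s & forall v, v \in s -> h v <= h u.
Proof.
elim: s => // x [|y s] IH _.
  by exists x; rewrite ?mem_head // => v; rewrite inE => /eqP ->.
have [//|u us hu] := IH.
have [xu|ux] := leP (h x) (h u).
  exists u; first by rewrite inE us orbT.
  by move=> v; rewrite inE => /orP[/eqP->//|]; exact: hu.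
exists x; first exact: mem_head.
by move=> v; rewrite inE => /orP[/eqP->//|/hu] vu; exact: le_trans (ltW ux).
Qed.

(** Compare leading terms for a functional h that separates the exponents of f and those of g. If u
    and v maximise h on the two supports, then u' + v' = u + v forces h u' = h u, hence u' = u and
    v' = v, so nothing cancels the product of the leading coefficients. *)
Lemma sgring_domain (K : idomainType) m (f g : sgring K 'rV[int]_m) :
  f * g = 0 -> f = 0 \/ g = 0.
Proof.
move=> fg0; apply: contrapT => /not_orP[/eqP f0 /eqP g0].
have msn (x : sgring K 'rV[int]_m) : x != 0 -> (msupp x : seq _) != [::].
  move=> x0; apply: contra x0 => /eqP x0; apply/eqP/malgP => v.
  by rewrite mcoeff0 mcoeff_outdom // -[_ \in _]/(v \in (msupp x : seq _)) x0.
pose s := [seq u - v | u <- msupp f, v <- msupp f] ++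
          [seq u - v | u <- msupp g, v <- msupp g].
have [h [hB hs]] := separating_functional s.
have h0 : h 0 = 0 by rewrite -(subr0 0) hB subrr.
have hN x : h (- x) = - h x by rewrite -[- x]add0r hB h0 add0r.
have hD x y : h (x + y) = h x + h y by rewrite -{1}[y]opprK hB hN opprK.
have [u uf hu] := int_argmax h (msn _ f0).
have [v vg hv] := int_argmax h (msn _ g0).
have : (f * g)@_(u + v) = f@_u * g@_v.
  rewrite sgcoeffM (bigD1_seq u) ?fset_uniq //=.
  rewrite (bigD1_seq v) ?fset_uniq //= eqxx mulr1n.
  rewrite [X in _ + X + _]big1_seq => [|v' /andP[v'v _]]; last first.
    by rewrite (inj_eq (addrI u)) (negPf v'v) mulr0n.
  rewrite addr0 big1_seq ?addr0 // => u' /andP[u'u u'f].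
  rewrite big1_seq // => v' /andP[_ v'g].
  case: eqP => [e|_]; last by rewrite mulr0n.
  case/eqP: u'u; apply/subr0_eq/hs.
    by rewrite mem_cat; apply/orP; left; apply/allpairsP; exists (u', u).
  rewrite hB; have := congr1 h e; rewrite !hD => e'.
  apply/eqP; rewrite eq_le subr_le0 hu //= subr_ge0.
  by rewrite -(lerD2r (h v)) -e' lerD2l hv.
rewrite fg0 mcoeff0 => /esym/eqP; rewrite mulf_eq0 !mcoeff_eq0.
by rewrite uf vg.
Qed.

(** * Lattice polytopes *)

Section Pairing.
Variable K : comNzRingType.

Lemma dotpE m (x y : 'rV[K]_m) : dotp x y = \sum_i x 0 i * y 0 i.
Proof. by rewrite /dotp mxE; apply: eq_bigr => i _; rewrite mxE. Qed.

Lemma dotpDr m (x y z : 'rV[K]_m) : dotp x (y + z) = dotp x y + dotp x z.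
Proof. by rewrite /dotp linearD /= mulmxDr mxE. Qed.

Lemma dotpZl m c (x y : 'rV[K]_m) : dotp (c *: x) y = c * dotp x y.
Proof. by rewrite /dotp -scalemxAl mxE. Qed.

Lemma dotpZr m c (x y : 'rV[K]_m) : dotp x (c *: y) = c * dotp x y.
Proof. by rewrite /dotp linearZ /= -scalemxAr mxE. Qed.

Lemma dotp0l m (y : 'rV[K]_m) : dotp 0 y = 0.
Proof. by rewrite /dotp mul0mx mxE. Qed.

Lemma dotp0r m (x : 'rV[K]_m) : dotp x 0 = 0.
Proof. by rewrite /dotp trmx0 mulmx0 mxE. Qed.

Lemma dotpNr m (x y : 'rV[K]_m) : dotp x (- y) = - dotp x y.
Proof. by rewrite /dotp linearN /= mulmxN mxE. Qed.

Lemma dotp_suml m (I : Type) (r : seq I) (F : I -> 'rV[K]_m) y :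
  dotp (\sum_(i <- r) F i) y = \sum_(i <- r) dotp (F i) y.
Proof. by rewrite /dotp mulmx_suml summxE. Qed.

Lemma dotp_sumr m (I : Type) (r : seq I) (F : I -> 'rV[K]_m) x :
  dotp x (\sum_(i <- r) F i) = \sum_(i <- r) dotp x (F i).
Proof. by rewrite /dotp linear_sum mulmx_sumr summxE. Qed.

Lemma dotp_row_mx m1 m2 (x1 y1 : 'rV[K]_m1) (x2 y2 : 'rV[K]_m2) :
  dotp (row_mx x1 x2) (row_mx y1 y2) = dotp x1 y1 + dotp x2 y2.
Proof. by rewrite /dotp tr_row_mx mul_row_col mxE. Qed.

Lemma dotp_delta m i (y : 'rV[K]_m) : dotp (delta_mx 0 i) y = y 0 i.
Proof. by rewrite /dotp -rowE !mxE. Qed.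

Lemma dotp_deltar m i (x : 'rV[K]_m) : dotp x (delta_mx 0 i) = x 0 i.
Proof. by rewrite -[RHS]dotp_delta !dotpE; apply: eq_bigr => j _; rewrite mulrC. Qed.

End Pairing.

Section LatticePolytopes.
Variables (R : realType) (m : nat).
Implicit Types (A : set 'rV[R]_m) (u v : 'rV[int]_m).

Lemma dotp_realv u v : dotp (realv R u) (realv R v) = (dotp u v)%:~R.
Proof.
rewrite !dotpE rmorph_sum; apply: eq_bigr => i _.
by rewrite !mxE rmorphM.
Qed.

Lemma realv_row_mx m1 m2 (u : 'rV[int]_m1) (v : 'rV[int]_m2) :
  realv R (row_mx u v) = row_mx (realv R u) (realv R v).
Proof. exact: map_row_mx. Qed.

Lemma inf_attained (E : set R) e : E e -> lbound E e -> inf E = e.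
Proof.
move=> Ee lbe; apply/le_anti; rewrite ge_inf //=; last by exists e.
by apply: lb_le_inf => //; exists e.
Qed.

Lemma exists_neq0_coeff n (l : 'I_n -> R) : \sum_i l i = 1 -> exists i, l i != 0.
Proof.
move=> l1; apply: contrapT => /forallNP nl; move: l1.
rewrite big1 => [/esym/eqP|i _].
  by rewrite oner_eq0.
by apply/eqP; rewrite -[_ == _]negbK; apply/negP/nl.
Qed.

Lemma lattice_polytope_min A (u : 'rV[R]_m) : lattice_polytope A -> A !=set0 ->
  exists v, A (realv R v) /\ forall x, A x -> dotp (realv R v) u <= dotp x u.
Proof.
move=> [s ->] [x0 [n [c [p [c0 c1 sp _]]]]].
have ns : s != [::].
  case: n c p c0 c1 sp => [|n] c p c0 c1 sp.
    by move: c1; rewrite big_ord0 => /esym/eqP; rewrite oner_eq0.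
  by have [v vs _] := sp ord0; apply: contraTneq vs => ->.
have [v vs hv] : exists2 v, v \in s &
    forall w, w \in s -> dotp (realv R v) u <= dotp (realv R w) u.
  elim: s ns {sp} => // v [|w s] IH _.
    by exists v; rewrite ?mem_head // => w; rewrite inE => /eqP ->.
  have [//|w' ws hw] := IH.
  have [vw|wv] := leP (dotp (realv R v) u) (dotp (realv R w') u).
    exists v; first exact: mem_head.
    by move=> z; rewrite inE => /orP[/eqP->//|/hw]; exact: le_trans.
  exists w'; first by rewrite inE ws orbT.
  by move=> z; rewrite inE => /orP[/eqP->|]; [exact: ltW|exact: hw].
exists v; split.
  exists 1%N, (fun=> 1), (fun=> realv R v); split => //.
  - by rewrite big_ord1.
  - by move=> _; exists v.
  - by rewrite big_ord1 scale1r.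
move=> _ [n' [c' [p' [c'0 c'1 sp' ->]]]].
rewrite dotp_suml -[leLHS]mul1r -c'1 mulr_suml; apply: ler_sum => i _.
by rewrite dotpZl ler_wpM2l //; have [w ws <-] := sp' i; exact: hv.
Qed.

Lemma min_pairingP A u : lattice_polytope A -> A !=set0 ->
  (exists v, A (realv R v) /\ min_pairing A u = dotp v u) /\
  forall x, A x -> (min_pairing A u)%:~R <= dotp x (realv R u).
Proof.
move=> latA A0; have [v [Av hv]] := lattice_polytope_min (realv R u) latA A0.
have e : min_pairing A u = dotp v u.
  rewrite /min_pairing; set E := (X in inf X).
  have Ev : lbound E (dotp v u)%:~R.
    by move=> _ [x Ax <-]; rewrite -dotp_realv hv.
  have Ev' : E (dotp v u)%:~R by exists (realv R v); rewrite ?dotp_realv.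
  by rewrite (inf_attained Ev' Ev) intrKfloor.
split; first by exists v.
by move=> x Ax; rewrite e -dotp_realv hv.
Qed.

(** The multiples t x tend to 0 with t, so they enter the neighbourhood A of 0. *)
Lemma interior0_absorbing A x : A^° 0 -> exists2 t : R, 0 < t & A (t *: x).
Proof.
move=> A0.
have := @scalel_continuous R _ x (0 : R) A; rewrite scale0r => /(_ A0).
move=> /nbhs_ballP[e /= e0 he]; exists (e / 2); first by rewrite divr_gt0.
apply: he; rewrite /ball /= sub0r normrN gtr0_norm ?divr_gt0 //.
by rewrite ltr_pdivrMr // mulr_natr mulr2n ltrDl.
Qed.

Lemma conv_sub A (C : set 'rV[R]_m) :
  (forall n (c : 'I_n -> R) (p : 'I_n -> 'rV[R]_m), (forall i, 0 <= c i) ->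
     \sum_i c i = 1 -> (forall i, C (p i)) -> C (\sum_i c i *: p i)) ->
  A `<=` C -> conv A `<=` C.
Proof.
move=> convC AC _ [n [c [p [c0 c1 Ap ->]]]].
by apply: convC => // i; exact: AC.
Qed.

Lemma sub_conv A : A `<=` conv A.
Proof.
move=> x Ax; exists 1%N, (fun=> 1), (fun=> x); split => //.
  by rewrite big_ord1.
by rewrite big_ord1 scale1r.
Qed.

(** The values at the points of a convex combination average to the lower bound c, so a point with
    nonzero weight takes the value c. This traces vertices of a hull back to its generators. *)
Lemma conv_exposed A x (u : 'rV[R]_m) c : (forall y, A y -> c <= dotp y u) ->
  conv A x -> dotp x u = c -> exists2 y, A y & dotp y u = c.
Proof.
move=> cu [n [l [p [l0 l1 Ap xE]]]] ux.
have [i li] := exists_neq0_coeff l1.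
exists (p i) => //.
have s0 : \sum_j l j * (dotp (p j) u - c) = 0.
  under eq_bigr do rewrite mulrBr; rewrite sumrB -mulr_suml l1 mul1r -ux xE.
  by rewrite dotp_suml -sumrB big1 // => j _; rewrite dotpZl subrr.
have ge0 j : true -> 0 <= l j * (dotp (p j) u - c).
  by rewrite mulr_ge0 // subr_ge0 cu.
have /eqP := psumr_eq0P ge0 s0 (erefl : xpredT i).
by rewrite mulf_eq0 (negPf li) subr_eq0 => /eqP.
Qed.

End LatticePolytopes.

(** * Ideals, gradings and images of closed subschemes *)

Section Span.
Variables (A : comNzRingType) (n : nat) (P : pred 'I_n) (F : 'I_n -> A).

(** For P true everywhere this is [ideal_of F], and for P j := (j < i) it is the ideal in
    [regular_sequence], both by conversion. *)
Definition span : set A := [set y | exists c, y = \sum_(j | P j) c j * F j].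

Lemma span0 : span 0.
Proof. by exists (fun=> 0); rewrite big1 // => j _; rewrite mul0r. Qed.

Lemma spanD x y : span x -> span y -> span (x + y).
Proof.
move=> [b ->] [c ->]; exists (fun j => b j + c j).
by rewrite -big_split; apply: eq_bigr => j _; rewrite mulrDl.
Qed.

Lemma spanM x y : span y -> span (x * y).
Proof.
move=> [c ->]; exists (fun j => x * c j).
by rewrite mulr_sumr; apply: eq_bigr => j _; rewrite mulrA.
Qed.

Lemma span_gen j : P j -> span (F j).
Proof.
move=> Pj; exists (fun i => (i == j)%:R).
rewrite (bigD1 j) //= eqxx mul1r big1 ?addr0 // => i /andP[_ /negPf ->].
by rewrite mul0r.
Qed.

Lemma spanMB x y z t : span (x - y) -> span (z - t) -> span (x * z - y * t).
Proof.
move=> xy zt; have -> : x * z - y * t = z * (x - y) + y * (z - t) by ring.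
by apply: spanD; exact: spanM.
Qed.

Lemma span_prodB (I : finType) (b : I -> nat) (x y : I -> A) :
  (forall i, span (x i - y i)) ->
  span (\prod_i x i ^+ b i - \prod_i y i ^+ b i).
Proof.
move=> xy; elim/big_rec2: _ => [|i p q _ pq]; first by rewrite subrr; exact: span0.
apply: spanMB => //; elim: (b i) => [|m IH]; first by rewrite subrr; exact: span0.
by rewrite !exprS; exact: spanMB.
Qed.

End Span.

Lemma subset_span (A : comNzRingType) n (P P' : pred 'I_n) (F : 'I_n -> A) :
  (forall j, P j -> P' j) -> span P F `<=` span P' F.
Proof.
move=> PP' _ [c ->]; apply: (big_ind (span P' F)); first exact: span0.
- exact: spanD.
by move=> j Pj; apply: spanM; apply: span_gen; exact: PP'.
Qed.

Lemma prod_if_exp (A : comNzRingType) (I : finType) (P : pred I) (x0 : A)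
    (x : I -> A) (b : I -> nat) :
  \prod_j (if P j then x0 else x j) ^+ b j =
  x0 ^+ (\sum_(j | P j) b j) * \prod_(j | ~~ P j) x j ^+ b j.
Proof.
rewrite (bigID P) /= -prodrXr; congr (_ * _); apply: eq_bigr => j.
  by move=> ->.
by move=> /negPf ->.
Qed.

(** * Monomials and homogeneous components in cone rings *)

Section ConeRing.
Variables (R : realType) (m : nat) (tau : set 'rV[R]_m).
Implicit Types u v : dual_semigroup tau.

Lemma lattice_ptD u v : lattice_pt (u + v) = lattice_pt u + lattice_pt v.
Proof. exact: (raddfD (val : dual_semigroup tau -> _)). Qed.

Lemma lattice_pt0 : lattice_pt (0 : dual_semigroup tau) = 0.
Proof. exact: (raddf0 (val : dual_semigroup tau -> _)). Qed.

Lemma lattice_ptMn u n : lattice_pt (u *+ n) = lattice_pt u *+ n.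
Proof.
by elim: n => [|n IH]; rewrite ?mulr0n ?lattice_pt0 // !mulrS lattice_ptD IH.
Qed.

Lemma lattice_pt_sum (I : Type) (r : seq I) (u : I -> dual_semigroup tau) :
  lattice_pt (\sum_(i <- r) u i) = \sum_(i <- r) lattice_pt (u i).
Proof. exact: (big_morph _ lattice_ptD lattice_pt0). Qed.

Definition monomial u : cone_ring tau := << u >>.

Lemma chiE w (hw : in_dual tau w) : chi tau w = monomial (DualSemigroup hw).
Proof. by rewrite /chi insubT. Qed.

Lemma monomialM u v : monomial u * monomial v = monomial (u + v).
Proof. exact: mulUU. Qed.

Lemma monomial_sum (I : finType) (u : I -> dual_semigroup tau) (b : I -> nat) :
  monomial (\sum_i u i *+ b i) = \prod_i monomial (u i) ^+ b i.
Proof.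
rewrite [LHS](@prodU R[i]); apply: eq_bigr => i _.
by rewrite -[LHS](@expU R[i]).
Qed.

End ConeRing.

Section Grading.
Variables (R : realType) (d l : nat) (tau : set 'rV[R]_(d + l)).
Implicit Types (f g : cone_ring tau) (e : int).

Lemma ldegD (x y : 'rV[int]_(d + l)) : ldeg (x + y) = ldeg x + ldeg y.
Proof. by rewrite /ldeg -big_split; apply: eq_bigr => j _; rewrite mxE. Qed.

Lemma cone_gr0 e : cone_gr e (0 : cone_ring tau).
Proof. by move=> w; rewrite msupp0. Qed.

Lemma cone_grD e f g : cone_gr e f -> cone_gr e g -> cone_gr e (f + g).
Proof.
move=> ef eg w /(fsubsetP (msuppD_le _ _)); rewrite in_fsetU.
by case/orP; [exact: ef|exact: eg].
Qed.

Lemma cone_grZ e c f : cone_gr e f -> cone_gr e (c *: f).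
Proof. by move=> ef w /(fsubsetP (msuppZ_le _ _)); exact: ef. Qed.

Lemma cone_gr_chi w : cone_gr (ldeg w) (chi tau w).
Proof.
rewrite /chi; case: insubP => [u _ <-|_]; last exact: cone_gr0.
by move=> v /(fsubsetP (msuppU_le)); rewrite in_fset1 => /eqP ->.
Qed.

Lemma cone_gr_sum e (I : eqType) (r : seq I) (F : I -> cone_ring tau) :
  (forall i, i \in r -> cone_gr e (F i)) -> cone_gr e (\sum_(i <- r) F i).
Proof.
move=> hF; rewrite big_seq; elim/big_ind: _ => //; first exact: cone_gr0.
exact: cone_grD.
Qed.

Definition component e : cone_ring tau -> cone_ring tau :=
  linext (fun u => if ldeg (lattice_pt u) == e then << u >> else 0).

HB.instance Definition _ e := GRing.Linear.on (component e).

Lemma component_gr e e' f : cone_gr e' f ->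
  component e f = if e' == e then f else 0.
Proof.
move=> hf; rewrite /component /linext; have [ee|ee] := eqVneq e' e.
  rewrite [RHS]sgringE; apply: eq_big_seq => u uf.
  by rewrite (hf u uf) ee eqxx.
rewrite big1_seq // => u /= uf.
by rewrite (hf u uf) (negPf ee) scaler0.
Qed.

Lemma component_homogeneous e f : cone_gr e (component e f).
Proof.
apply: cone_gr_sum => u _; apply: cone_grZ; case: eqP => [<- v|_].
  by move=> /(fsubsetP (msuppU_le)); rewrite in_fset1 => /eqP ->.
exact: cone_gr0.
Qed.

Lemma component_sum f : exists s : seq int, f = \sum_(e <- s) component e f.
Proof.
(* Duplicates are removed so that each monomial is counted in exactly one component. *)
exists (undup [seq ldeg (lattice_pt u) | u <- msupp f]).
rewrite /component /linext exchange_big /= {1}[f]sgringE.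
apply: eq_big_seq => u uf.
rewrite (bigD1_seq (ldeg (lattice_pt u))) ?undup_uniq //=; last first.
  by rewrite mem_undup; apply: (map_f (fun u => ldeg (lattice_pt u))).
rewrite eqxx big1 ?addr0 // => e /negPf ne.
by rewrite eq_sym ne scaler0.
Qed.

End Grading.

(** The kernel P_m of [phi m] is prime and generated by the F_j with 0 < j < m. If F_i x = c F_0 + l
    with l in P_i, then c F_0 lies in P_(i+1), hence so does c, and c = b F_i + l' with l' in P_i.
    Thus F_i (x - b F_0) lies in P_i, and so does x - b F_0. *)
Lemma regular_of_kernels (A C : comNzRingType) n (F : 'I_n.+1 -> A)
    (phi : nat -> {rmorphism A -> C})
    (early := fun m => [pred j : 'I_n.+1 | (j != ord0) && (j < m)%N]) :
  (forall x y : C, x * y = 0 -> x = 0 \/ y = 0) ->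
  (forall m f, (0 < m)%N -> phi m f = 0 -> span (early m) F f) ->
  (forall m j, early m j -> phi m (F j) = 0) ->
  (forall m, (0 < m)%N -> phi m (F ord0) <> 0) ->
  (forall j : 'I_n.+1, j != ord0 -> phi j (F j) <> 0) ->
  forall (i : 'I_n.+1) x, span (fun j : 'I_n.+1 => (j < i)%N) F (F i * x) ->
    span (fun j : 'I_n.+1 => (j < i)%N) F x.
Proof.
move=> dom ker_phi phi_early phi_F0 phi_F i x.
have phi_span m y : span (early m) F y -> phi m y = 0.
  move=> [c ->]; rewrite rmorph_sum big1 // => j jm.
  by rewrite rmorphM /= phi_early // mulr0.
have early_sub m : span (early m) F `<=` span (fun j : 'I_n.+1 => (j < m)%N) F.
  by apply: subset_span => j /andP[].
(* For i = 0 the ideal is zero, and so is the one spanned by [early 1]: [phi 1] is injective. *)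
have [->|i0] := eqVneq i ord0.
  have to_early y : span (fun j : 'I_n.+1 => (j < @ord0 n)%N) F y ->
      span (early 1%N) F y by apply: subset_span.
  move=> /to_early/phi_span; rewrite rmorphM => /dom[f0|x0].
    by case: (phi_F0 1%N isT).
  apply: subset_span (ker_phi 1%N x isT x0) => j /andP[/eqP j0].
  by rewrite ltnS leqn0 => /eqP jz; case: j0; exact: val_inj.
have i_gt0 : (0 < i)%N by rewrite lt0n.
move=> [c Fix]; pose l := \sum_(j | early i j) c j * F j.
have spl : span (early i) F l by exists c.
have {}Fix : F i * x = c ord0 * F ord0 + l.
  rewrite Fix (bigD1 ord0) //=; congr (_ + _).
  by apply: eq_bigl => j; rewrite /= andbC.
have c0 : phi i.+1 (c ord0) = 0.
  have [//|f0] : phi i.+1 (c ord0) = 0 \/ phi i.+1 (F ord0) = 0; last first.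
    by case: (phi_F0 i.+1 isT).
  apply: dom; rewrite -rmorphM -[c ord0 * _](addrK l) -Fix rmorphB rmorphM.
  rewrite phi_early ?mul0r ?sub0r /= ?i0 ?ltnSn // phi_span ?oppr0 //.
  by apply: subset_span spl => j /= /andP[-> /ltnW].
have [b bE] := ker_phi i.+1 _ isT c0.
pose l' := \sum_(j | early i j) b j * F j.
have spl' : span (early i) F l' by exists b.
have {}bE : c ord0 = b i * F i + l'.
  rewrite bE (bigD1 i) /= ?i0 ?ltnSn //; congr (_ + _).
  apply: eq_bigl => j /=.
  by rewrite -andbA ltnS [in RHS]ltn_neqAle [_ && (j != i)]andbC.
have spx : span (early i) F (F i * (x - b i * F ord0)).
  have -> : F i * (x - b i * F ord0) = F ord0 * l' + l.
    by rewrite mulrBr Fix bE; ring.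
  by apply: spanD => //; exact: spanM.
have : phi i (x - b i * F ord0) = 0.
  have := phi_span _ _ spx; rewrite rmorphM => /dom[f0|//].
  by case: (phi_F i i0).
move=> /(ker_phi _ _ i_gt0)/early_sub xb; rewrite -[x](subrK (b i * F ord0)).
by apply: spanD => //; apply: spanM; exact: span_gen.
Qed.

(** If phi x = phi b * f, then x - b F_0 is in the kernel, which the remaining F_j generate. *)
Lemma ideal_of_preimage (B A : comNzRingType) n (F : 'I_n.+1 -> B)
    (phi : {rmorphism B -> A}) f :
  (forall y, exists x, phi x = y) ->
  (forall x, phi x = 0 -> span (fun j => j != ord0) F x) ->
  phi (F ord0) = f -> (forall j, j != ord0 -> phi (F j) = 0) ->
  forall x, ideal_of F x <-> ideal_of (fun _ : 'I_1 => f) (phi x).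
Proof.
move=> surj ker_phi F0 Fj x; split=> [[c ->]|[c]].
  exists (fun=> phi (c ord0)); rewrite big_ord1 rmorph_sum (bigD1 ord0) //=.
  rewrite rmorphM /= F0 big1 ?addr0 // => j /Fj Fj0.
  by rewrite rmorphM /= Fj0 mulr0.
rewrite big_ord1; have [b <-] := surj (c ord0); rewrite -F0 => xE.
have /ker_phi xb : phi (x - b * F ord0) = 0.
  by rewrite rmorphB rmorphM xE subrr.
rewrite -[x](subrK (b * F ord0)); apply: (@spanD _ _ xpredT F).
  by apply: subset_span xb.
by apply: spanM; exact: span_gen.
Qed.

(** * Closed subschemes under a surjective graded homomorphism *)

Section ProjImage.
Variables (B A : comNzRingType) (grB : int -> set B) (grA : int -> set A).
Variables (phi : {rmorphism B -> A}) (I : set A) (J : set B).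
Variables (compB : int -> B -> B) (compA : int -> A -> A).
Hypothesis compA_linear : forall e (s : seq A),
  compA e (\sum_(y <- s) y) = \sum_(y <- s) compA e y.
Hypothesis compA_gr : forall e e' y, grA e' y ->
  compA e y = if e' == e then y else 0.
Hypothesis compB_gr : forall e x, grB e (compB e x).
Hypothesis compB_sum : forall x, exists s : seq int, x = \sum_(e <- s) compB e x.
Hypothesis phi_comp : forall e x, phi (compB e x) = compA e (phi x).
Hypothesis phi_gr : forall e x, grB e x -> grA e (phi x).
Hypothesis phi_lift : forall y, exists x, phi x = y /\
  forall e, grA e y -> grB e x.
Hypothesis JE : forall x, J x <-> I (phi x).
Hypothesis I0 : I 0.

(** The preimage of q is homogeneous because phi commutes with taking components, and a component of
    phi x is a sum of homogeneous elements of q. A homogeneous element outside q is lifted in its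
    own degree, so the preimage is relevant. *)
Lemma preimage_in_Vplus (p : {pred B}) (q : {pred A}) :
  in_Vplus grA I q -> p =i [preim phi of q] -> in_Vplus grB J p.
Proof.
move=> [[[q0 q1 qD] qP qH [e [y [e0 ye yq]]]] Iq] pq.
have q_sum (s : seq A) : (forall z, z \in s -> z \in q) -> \sum_(z <- s) z \in q.
  elim: s => [|z s IH] sq; first by rewrite big_nil.
  rewrite big_cons -[z]mul1r; apply: qD; first by apply: sq; rewrite mem_head.
  by apply: IH => t ts; apply: sq; rewrite inE ts orbT.
split; last by move=> x /JE/Iq; rewrite pq.
split.
- split=> [||b u v]; rewrite !pq !inE ?rmorph0 ?rmorph1 //.
  by move=> uq vq; rewrite rmorphD rmorphM; exact: qD.
- by move=> u v; rewrite !pq !inE rmorphM; exact: qP.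
- move=> x; rewrite pq inE => /qH[s [hs xs]]; have [t xt] := compB_sum x.
  exists [seq compB e x | e <- t]; split; last by rewrite big_map -xt.
  move=> _ /mapP[e' _ ->]; split; last by exists e'.
  rewrite pq inE phi_comp xs compA_linear -(big_map (compA e') xpredT id).
  apply: q_sum => _ /mapP[z /hs[zq [e'' ze]] ->].
  by rewrite (compA_gr _ ze); case: ifP.
have [x [xy xe]] := phi_lift y.
by exists e, x; split => //; [exact: xe|rewrite pq inE xy].
Qed.

(** The prime q is the direct image of p. Since p contains J and J contains the kernel of phi,
    membership in p can be read off after phi. *)
Lemma in_Vplus_image (p : {pred B}) : in_Vplus grB J p ->
  exists q : {pred A}, in_Vplus grA I q /\ p =i [preim phi of q].
Proof.
move=> [[[p0 p1 pD] pP pH [e [x [e0 xe xp]]]] Jp].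
pose q : {pred A} := fun y => `[< exists2 x, x \in p & phi x = y >].
have pq z : (z \in p) = (phi z \in q).
  apply/idP/asboolP => [zp|[x' x'p xz]]; first by exists z.
  have : z - x' \in p by apply: Jp; apply/JE; rewrite rmorphB xz subrr.
  by move=> zx; have := pD 1 _ _ zx x'p; rewrite mul1r subrK.
exists q; split; last exact: pq.
split; last first.
  by move=> y Iy; have [z [zy _]] := phi_lift y; rewrite -zy -pq Jp // JE zy.
split.
- split; rewrite -?(rmorph0 phi) -?(rmorph1 phi) -?pq // => b u v.
  have [b' [<- _]] := phi_lift b; have [u' [<- _]] := phi_lift u.
  have [v' [<- _]] := phi_lift v.
  by rewrite -rmorphM -rmorphD -!pq; exact: pD.
- move=> u v; have [u' [<- _]] := phi_lift u; have [v' [<- _]] := phi_lift v.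
  by rewrite -rmorphM -!pq; exact: pP.
- move=> y; have [z [<- _]] := phi_lift y; rewrite -pq => /pH[s [hs ->]].
  exists [seq phi t | t <- s]; split; last by rewrite rmorph_sum big_map.
  move=> _ /mapP[t /hs[tp [e' te]] ->]; rewrite -pq; split => //.
  by exists e'; exact: phi_gr.
by exists e, (phi x); rewrite -pq; split => //; exact: phi_gr.
Qed.

(** As J is the preimage of I, the sheaf condition holds with the same power of g on both sides. *)
Lemma is_image_preimage : is_image grA grB phi I J.
Proof.
split=> [p|e r g b _ _ _].
  by split=> [/in_Vplus_image //|[q []]]; exact: preimage_in_Vplus.
by split=> -[s hs]; exists s; move: hs; rewrite JE rmorphM rmorphXn.
Qed.

End ProjImage.

(** * The Cayley cone and its support functions *)

Section Projection.
Variables (K : comNzRingType) (k : nat).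
Implicit Types s t : 'rV[K]_k.+1.

(* In the coordinates (t_0, t_1 - t_0, ..., t_k - t_0), the fan of the Cayley
   polytope is obtained by forgetting t_0. *)
Definition shear t : 'rV[K]_k := \row_(i < k) (t 0 (lift ord0 i) - t 0 ord0).

Definition tail t : 'rV[K]_k := \row_(i < k) t 0 (lift ord0 i).

Lemma shear_is_linear : linear shear.
Proof. by move=> c s t; apply/rowP => i; rewrite !mxE; ring. Qed.

HB.instance Definition _ :=
  GRing.isLinear.Build K 'rV[K]_k.+1 'rV[K]_k *:%R shear shear_is_linear.

Lemma shear_delta j : shear (delta_mx 0 j) = e_vec K j :> 'rV_k.
Proof.
apply/rowP => i; rewrite /e_vec !mxE /=.
case: (unliftP ord0 j) => [j'|] ->.
  by rewrite (inj_eq lift_inj) -[ord0 == _]eq_sym [_ == ord0]eq_sym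
    (negPf (neq_lift _ _)) subr0 mxE.
rewrite eq_sym (negPf (neq_lift _ _)) eqxx sub0r mxE summxE (bigD1 i) //=.
rewrite mxE !eqxx big1 ?addr0 // => l /negPf li.
by rewrite mxE eq_sym li andbF.
Qed.

(** The dual change of coordinates replaces t_0 by the total degree of t. *)
Lemma dotp_shear s t :
  dotp s t = dotp (shear s) (tail t) + s 0 ord0 * \sum_j t 0 j.
Proof.
rewrite !dotpE !big_ord_recl mulrDr mulr_sumr addrCA -big_split /=.
by congr (_ + _); apply: eq_bigr => i _; rewrite !mxE; ring.
Qed.

Lemma sum_delta j : \sum_i (delta_mx 0 j : 'rV[K]_k.+1) 0 i = 1.
Proof.
rewrite (bigD1 j) //= mxE !eqxx big1 ?addr0 // => i /negPf ij.
by rewrite mxE ij andbF.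
Qed.

Lemma sum_scaled_r_vec d (c : 'I_k.+1 -> int) :
  \sum_j c j *: r_vec d j = row_mx 0 (\row_j c j).
Proof.
rewrite [\row_j _]row_sum_delta; elim/big_ind2: _ => //.
- by rewrite row_mx0.
- by move=> ? y1 ? y2 -> ->; rewrite add_row_mx addr0.
by move=> j _; rewrite mxE scale_row_mx scaler0.
Qed.

Lemma sum_e_vec : \sum_j e_vec K j = 0 :> 'rV_k.
Proof.
under eq_bigr do rewrite -shear_delta; rewrite -linear_sum /=.
rewrite (_ : \sum_j _ = const_mx 1); first by apply/rowP => i; rewrite !mxE subrr.
rewrite [RHS]row_sum_delta; apply: eq_bigr => j _.
by rewrite mxE scale1r.
Qed.

End Projection.

Lemma realv_e_vec (R : realType) k j :
  realv R (e_vec int (k := k) j) = e_vec R j.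
Proof.
rewrite /e_vec; case: unlift => [i|]; first exact: map_delta_mx.
rewrite /realv map_mxN raddf_sum; congr (- _).
by apply: eq_bigr => l _; exact: map_delta_mx.
Qed.

Lemma realv_inj (R : realType) m : injective (@realv R m).
Proof.
move=> u v /rowP uv; apply/rowP => i.
by have := uv i; rewrite !mxE => /intr_inj.
Qed.

Lemma dotpC (K : comNzRingType) m (x y : 'rV[K]_m) : dotp x y = dotp y x.
Proof. by rewrite !dotpE; apply: eq_bigr => i _; rewrite mulrC. Qed.

Section ReflexiveSum.
Variables (R : realType) (d k : nat) (Delta_ : 'I_k.+1 -> set 'rV[R]_d).
Hypothesis lat_Delta_ : forall j, lattice_polytope (Delta_ j).
Hypothesis refl_Delta : reflexive_polytope (minkowski_sum Delta_).
Let Delta := minkowski_sum Delta_.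

Lemma minkowski_sum0 : Delta 0.
Proof. by have [_ + _] := refl_Delta; exact: interior_subset. Qed.

Lemma summand_neq0 j : Delta_ j !=set0.
Proof. by have [y [hy _]] := minkowski_sum0; exists (y j). Qed.

Lemma min_pairing_le j y n : Delta_ j y ->
  (min_pairing (Delta_ j) n)%:~R <= dotp y (realv R n).
Proof. by have [_] := min_pairingP n (lat_Delta_ j) (summand_neq0 j); exact. Qed.

Lemma min_pairing_attained j n :
  exists v, Delta_ j (realv R v) /\ min_pairing (Delta_ j) n = dotp v n.
Proof. by have [] := min_pairingP n (lat_Delta_ j) (summand_neq0 j). Qed.

(** As 0 is interior, Delta contains a positive multiple of -u, where the functional is a negative
    multiple of the square norm of u. *)
Lemma nonneg_functional0 (u : 'rV[R]_d) :
  (forall x, Delta x -> 0 <= dotp x u) -> u = 0.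
Proof.
move=> hu; have [_ D0 _] := refl_Delta.
have [t t0 /hu] := interior0_absorbing (- u) D0.
rewrite dotpZl pmulr_rge0 // dotpC dotpNr oppr_ge0 dotpE => le0.
have sq i : xpredT i -> 0 <= u 0 i * u 0 i by rewrite -expr2 sqr_ge0.
apply/rowP => i; rewrite mxE; apply/eqP.
have /(psumr_eq0P sq) : \sum_i u 0 i * u 0 i = 0.
  by apply/le_anti; rewrite le0 sumr_ge0.
by move=> /(_ i isT)/eqP; rewrite mulf_eq0 orbb.
Qed.

Lemma sum_min_pairing_ge n : lattice_points (polar Delta) n ->
  -1 <= \sum_j min_pairing (Delta_ j) n.
Proof.
move=> pn; have /choice[v hv] := fun j => min_pairing_attained j n.
have : -1 <= dotp (\sum_j realv R (v j)) (realv R n).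
  by apply: pn; exists (fun j => realv R (v j)); split => // j; have [] := hv j.
rewrite dotp_suml (eq_bigr (fun j => (min_pairing (Delta_ j) n)%:~R)).
  by rewrite -rmorph_sum -(ler_int R).
by move=> j _; have [_ ->] := hv j; rewrite dotp_realv.
Qed.

(** A nonzero functional takes a negative value on Delta because 0 is interior; by integrality the
    minimum is then at most -1. *)
Lemma sum_min_pairing n : lattice_points (polar Delta) n -> n != 0 ->
  \sum_j min_pairing (Delta_ j) n = -1.
Proof.
move=> pn n0; apply/le_anti; rewrite sum_min_pairing_ge // andbT.
suff : \sum_j min_pairing (Delta_ j) n < 0 by rewrite -ltzD1 addNr.
have [x [y [hy ->]] xn] : exists2 x, Delta x & dotp x (realv R n) < 0.
  apply: contrapT => h; case/eqP: n0; apply: (@realv_inj R).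
  rewrite [RHS]map_mx0; apply: nonneg_functional0 => x Dx.
  by rewrite leNgt; apply/negP => xn; apply: h; exists x.
rewrite -(ltr_int R) rmorph_sum; apply: le_lt_trans xn.
by rewrite dotp_suml; apply: ler_sum => j _; exact: min_pairing_le.
Qed.

Lemma sigma_bar_generator j y : Delta_ j y ->
  sigma_bar Delta_ (row_mx y (delta_mx 0 j)).
Proof.
(* The cone asks for a point of every summand; the arbitrary z_i get weight 0. *)
move=> hy; have /choice[z hz] := summand_neq0.
exists (delta_mx 0 j), (fun i => if i == j then y else z i); split.
- by move=> i; rewrite mxE; case: andP.
- by move=> i; case: eqP => [->|].
congr row_mx; rewrite (bigD1 j) //= mxE !eqxx scale1r big1 ?addr0 // => i.
by move=> /negPf ij; rewrite mxE ij andbF scale0r.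
Qed.

Lemma dual_sigma_barP w : dual_cone (sigma_bar Delta_) w <->
  forall j y, Delta_ j y -> 0 <= dotp y (lsubmx w) + rsubmx w 0 j.
Proof.
split=> [hw j y hy|hw _ [t [x [t0 hx ->]]]].
  have := hw _ (sigma_bar_generator hy).
  by rewrite -{1}[w]hsubmxK dotp_row_mx dotp_delta.
rewrite -[w]hsubmxK dotp_row_mx dotp_suml dotpE -big_split /=.
by apply: sumr_ge0 => j _; rewrite dotpZl -mulrDr mulr_ge0 ?hw.
Qed.

Lemma in_dual_sigma_barP w : reflect
  (forall j, - min_pairing (Delta_ j) (lsubmx w) <= rsubmx w 0 j)
  (in_dual (sigma_bar Delta_) w).
Proof.
have lE : lsubmx (realv R w) = realv R (lsubmx w) by apply/rowP => i; rewrite !mxE.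
have rE j : rsubmx (realv R w) 0 j = (rsubmx w 0 j)%:~R by rewrite !mxE.
rewrite /in_dual; apply: (iffP (asboolP _)) => [/dual_sigma_barP hw j|hw].
  have [v [hv ->]] := min_pairing_attained j (lsubmx w).
  have := hw j _ hv; rewrite lE rE dotp_realv -intrD ler0z.
  by rewrite -lerBlDl sub0r.
apply/dual_sigma_barP => j y hy; rewrite lE rE.
rewrite -lerBlDl sub0r.
apply: le_trans (_ : (- min_pairing (Delta_ j) (lsubmx w))%:~R <= _).
  by rewrite rmorphN lerN2 min_pairing_le.
by rewrite ler_int.
Qed.


(** The projection along (0, (1, ..., 1)), which sends (y, r_j) to (y, e_j). *)
Definition cayley_proj (K : comNzRingType) (z : 'rV[K]_(d + k.+1)) :
    'rV[K]_(d + k) := row_mx (lsubmx z) (shear (rsubmx z)).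

Definition drop_first (K : comNzRingType) (w : 'rV[K]_(d + k.+1)) :
    'rV[K]_(d + k) := row_mx (lsubmx w) (tail (rsubmx w)).

Fact cayley_proj_is_linear (K : comNzRingType) : linear (@cayley_proj K).
Proof.
by move=> c x y; rewrite /cayley_proj !linearP scale_row_mx add_row_mx.
Qed.

HB.instance Definition _ (K : comNzRingType) :=
  GRing.isLinear.Build K 'rV[K]_(d + k.+1) 'rV[K]_(d + k) *:%R (@cayley_proj K)
    (@cayley_proj_is_linear K).

(** For w of degree 0 the pairing factors through the projection; for w of degree 1 it differs from
    the pairing with r_0 by such a function. Hence all monomials of degree 1 have equivalent
    divisors. *)
Lemma dotp_cayley_proj (K : comNzRingType) (z w : 'rV[K]_(d + k.+1)) :
  dotp z w = dotp (cayley_proj z) (drop_first w) +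
             rsubmx z 0 ord0 * \sum_j rsubmx w 0 j.
Proof.
by rewrite -[z in LHS]hsubmxK -[w in LHS]hsubmxK !dotp_row_mx dotp_shear addrA.
Qed.

Lemma realv_drop_first w :
  realv R (drop_first w) = drop_first (realv R w).
Proof.
rewrite /drop_first realv_row_mx; congr row_mx; apply/rowP => i; rewrite !mxE //.
Qed.

Lemma ldegE (w : 'rV[int]_(d + k.+1)) : ldeg w = \sum_j rsubmx w 0 j.
Proof. by apply: eq_bigr => j _; rewrite mxE. Qed.

Lemma sum_rsubmx_realv (w : 'rV[int]_(d + k.+1)) :
  \sum_j rsubmx (realv R w) 0 j = (ldeg w)%:~R.
Proof. by rewrite ldegE rmorph_sum; apply: eq_bigr => j _; rewrite !mxE. Qed.

(** The least lattice point of the dual cone over n: its last coordinates are the bounds in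
    [in_dual_sigma_barP]. *)
Definition base_pt (n : 'rV[int]_d) : 'rV[int]_(d + k.+1) :=
  row_mx n (\row_j - min_pairing (Delta_ j) n).

Lemma in_dual_base_pt n : in_dual (sigma_bar Delta_) (base_pt n).
Proof.
apply/in_dual_sigma_barP => j.
by rewrite /base_pt row_mxKl row_mxKr mxE.
Qed.

Lemma in_dual_r_vec j : in_dual (sigma_bar Delta_) (r_vec d j).
Proof.
apply/in_dual_sigma_barP => i; rewrite /r_vec row_mxKl row_mxKr mxE.
have [v [_ ->]] := min_pairing_attained i 0; rewrite dotp0r oppr0.
by case: andP.
Qed.

(* The double dual is used in place of the closed cone [sigma_bar] itself: it
   is visibly stable under addition. *)
Let bidual := dual_cone (dual_cone (sigma_bar Delta_)).

Lemma bidual_ge0 z w : bidual z -> dual_cone (sigma_bar Delta_) w ->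
  0 <= dotp z w.
Proof. by move=> bz dw; rewrite dotpC; exact: bz. Qed.

Lemma bidual_sigma_bar z : sigma_bar Delta_ z -> bidual z.
Proof. by move=> sz w dw; rewrite dotpC; exact: dw. Qed.

Lemma bidual_sum n (c : 'I_n -> R) (z : 'I_n -> 'rV[R]_(d + k.+1)) :
  (forall i, 0 <= c i) -> (forall i, bidual (z i)) ->
  bidual (\sum_i c i *: z i).
Proof.
move=> c0 bz w dw; rewrite dotp_sumr; apply: sumr_ge0 => i _.
by rewrite dotpZr mulr_ge0 // bz.
Qed.

Lemma bidualD x y : bidual x -> bidual y -> bidual (x + y).
Proof. by move=> bx by_ w dw; rewrite dotpDr addr_ge0 ?bx ?by_. Qed.

Lemma bidual_first_ge0 z : bidual z -> 0 <= rsubmx z 0 ord0.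
Proof.
move=> /bidual_ge0/(_ (asboolP _ (in_dual_r_vec ord0))).
rewrite -{1}[z]hsubmxK /r_vec realv_row_mx dotp_row_mx /realv map_mx0 dotp0r.
by rewrite add0r map_delta_mx dotp_deltar.
Qed.

Lemma bidual_generator j y : Delta_ j y -> bidual (row_mx y (delta_mx 0 j)).
Proof.
by move=> hy; apply: bidual_sigma_bar; exact: sigma_bar_generator.
Qed.

Lemma cayley_proj_generator (K : comNzRingType) (y : 'rV[K]_d) j :
  cayley_proj (row_mx y (delta_mx 0 j)) = row_mx y (e_vec K j).
Proof. by rewrite /cayley_proj row_mxKl row_mxKr shear_delta. Qed.

(** * Faces of the Cayley polytope and their lifts to the Cayley cone *)

Let Q := cayley_polytope Delta_.

Lemma cayley_generator j y : Delta_ j y -> Q (row_mx y (e_vec R j)).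
Proof.
move=> hy; apply: sub_conv; exists j => //; apply: sub_conv.
by left; exists y.
Qed.

Lemma cayley0 : Q 0.
Proof. by apply: sub_conv; exists ord0 => //; apply: sub_conv; right. Qed.

(** Generators lift to height 1 and the origin to height 0; the property is convex, and it passes
    through both nested hulls. *)
Lemma cayley_lift x : Q x -> exists z,
  [/\ bidual z, cayley_proj z = x & \sum_j rsubmx z 0 j <= 1].
Proof.
pose C := [set x | exists z,
  [/\ bidual z, cayley_proj z = x & \sum_j rsubmx z 0 j <= 1]].
have convC n (c : 'I_n -> R) (p : 'I_n -> 'rV[R]_(d + k)) :
    (forall i, 0 <= c i) -> \sum_i c i = 1 -> (forall i, C (p i)) ->
    C (\sum_i c i *: p i).
  move=> c0 c1 /choice[z hz]; exists (\sum_i c i *: z i); split.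
  - by apply: bidual_sum => // i; have [] := hz i.
  - rewrite linear_sum; apply: eq_bigr => i _.
    by rewrite linearZ /=; have [_ ->] := hz i.
  under eq_bigr do rewrite linear_sum summxE.
  rewrite exchange_big /= -c1; apply: ler_sum => i _.
  under eq_bigr do rewrite linearZ mxE.
  by rewrite -mulr_sumr ler_piMr //; have [] := hz i.
apply: (conv_sub convC) => y [j _]; apply: (conv_sub convC) => {}y.
move=> [[x' hx' <-]|->].
  exists (row_mx x' (delta_mx 0 j)); split.
  - exact: bidual_generator.
  - exact: cayley_proj_generator.
  by rewrite row_mxKr sum_delta.
exists 0; split; rewrite ?linear0 //.
  by move=> w dw; rewrite dotp0r.
by rewrite big1 // => i _; rewrite mxE.
Qed.

(* The inequalities <sum_j y_j, n_l> >= -1 average to an equality, hence those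
   with c_l <> 0 are equalities. *)
Lemma polar_decomposition u (y : 'I_k.+1 -> 'rV[R]_d) :
  (forall j, Delta_ j (y j)) -> polar Delta u -> dotp (\sum_j y j) u = -1 ->
  exists N (c : 'I_N -> R) (n : 'I_N -> 'rV[int]_d),
    [/\ forall l, 0 <= c l, \sum_l c l = 1, u = \sum_l c l *: realv R (n l)
      & forall l, c l != 0 -> \sum_j min_pairing (Delta_ j) (n l) = -1 /\
          forall j, dotp (y j) (realv R (n l)) =
                    (min_pairing (Delta_ j) (n l))%:~R].
Proof.
move=> hy pu yu; have [_ _ [s sE]] := refl_Delta.
have [N [c [q [c0 c1 sq uE]]]] : conv [set realv R v | v in [set` s]] u.
  by rewrite -sE.
have /choice[n hn] : forall l, exists n, realv R n = q l.
  by move=> l; have [n _ <-] := sq l; exists n.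
have polq l : lattice_points (polar Delta) (n l).
  by rewrite /lattice_points /= hn sE; exact: sub_conv.
have Dy : Delta (\sum_j y j) by exists y.
have ge0 l : true -> 0 <= c l * (dotp (\sum_j y j) (q l) + 1).
  by rewrite mulr_ge0 // -lerBlDr sub0r -hn; exact: polq.
have s0 : \sum_l c l * (dotp (\sum_j y j) (q l) + 1) = 0.
  under eq_bigr do rewrite mulrDr mulr1 -dotpZr.
  by rewrite big_split /= c1 -dotp_sumr -uE yu addNr.
exists N, c, n; split => // [|l cl].
  by rewrite uE; apply: eq_bigr => l _; rewrite hn.
have yq : dotp (\sum_j y j) (q l) = -1.
  have /eqP := psumr_eq0P ge0 s0 (erefl : xpredT l).
  by rewrite mulf_eq0 (negPf cl) addr_eq0 => /eqP.
have ge0' j : true -> 0 <= dotp (y j) (q l) - (min_pairing (Delta_ j) (n l))%:~R.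
  by rewrite subr_ge0 -hn min_pairing_le.
have mq : \sum_j min_pairing (Delta_ j) (n l) = -1.
  apply/le_anti; rewrite sum_min_pairing_ge // andbT.
  rewrite -(ler_int R) rmorphN rmorph1 -yq dotp_suml rmorph_sum.
  by apply: ler_sum => j _; rewrite -subr_ge0 ge0'.
split=> // j; rewrite hn; apply/eqP; rewrite -subr_eq0; apply/eqP.
apply: (psumr_eq0P ge0') => //.
by rewrite sumrB -dotp_suml yq -rmorph_sum mq subrr.
Qed.

Lemma sum_dotp_e_vec (t : 'rV[R]_k.+1) u :
  dotp (shear t) u = \sum_j t 0 j * dotp (e_vec R j) u.
Proof.
rewrite {1}[t]row_sum_delta linear_sum dotp_suml; apply: eq_bigr => j _.
by rewrite linearZ /= dotpZl shear_delta.
Qed.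

(** Subtracting c from the last coordinates makes w take the value <(y, e_j), u> - c on the
    generator (y, r_j). *)
Lemma cayley_supporting u c (alpha := \row_j (dotp (e_vec R j) (rsubmx u) - c))
    (w := row_mx (lsubmx u) alpha) :
  (forall x, Q x -> c <= dotp x u) ->
  dual_cone (sigma_bar Delta_) w /\
  forall z, dotp z w = dotp (cayley_proj z) u - c * \sum_j rsubmx z 0 j.
Proof.
move=> cu; split.
  apply/dual_sigma_barP => // j y hy; rewrite /w row_mxKl row_mxKr mxE.
  have := cu _ (cayley_generator hy).
  by rewrite -{1}[u]hsubmxK dotp_row_mx -subr_ge0 addrA.
move=> z; rewrite -{1}[z]hsubmxK /w dotp_row_mx.
have -> : dotp (cayley_proj z) u =
    dotp (lsubmx z) (lsubmx u) + dotp (shear (rsubmx z)) (rsubmx u).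
  by rewrite -{1}[u]hsubmxK dotp_row_mx.
rewrite sum_dotp_e_vec -addrA mulr_sumr -sumrB; congr (_ + _).
by rewrite dotpE; apply: eq_bigr => j _; rewrite [alpha _ _]mxE; ring.
Qed.

(** The e_j sum to 0, so adding the inequalities at (y_j, e_j) shows that the first part of u is
    nonnegative on Delta, hence 0. The values at the e_j are then nonnegative with sum 0. *)
Lemma cayley_nonneg_functional0 u : (forall x, Q x -> 0 <= dotp x u) -> u = 0.
Proof.
move=> hu; rewrite -[u]hsubmxK.
have hg j y : Delta_ j y -> 0 <= dotp y (lsubmx u) + dotp (e_vec R j) (rsubmx u).
  by move=> /cayley_generator/hu; rewrite -{1}[u]hsubmxK dotp_row_mx.
have l0 : lsubmx u = 0.
  apply: nonneg_functional0 => _ [y [hy ->]].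
  have -> : dotp (\sum_j y j) (lsubmx u) = \sum_j
      (dotp (y j) (lsubmx u) + dotp (e_vec R j) (rsubmx u)).
    by rewrite big_split -!dotp_suml /= sum_e_vec dotp0l addr0.
  by apply: sumr_ge0 => j _; exact: hg.
have ge0 j : true -> 0 <= dotp (e_vec R j) (rsubmx u).
  by have [y /hg] := summand_neq0 j; rewrite l0 dotp0r add0r.
have s0 : \sum_j dotp (e_vec R j) (rsubmx u) = 0.
  by rewrite -dotp_suml sum_e_vec dotp0l.
rewrite l0 (_ : rsubmx u = 0) ?row_mx0 //; apply/rowP => i; rewrite [RHS]mxE.
have := psumr_eq0P ge0 s0 (erefl : xpredT (lift ord0 i)).
by rewrite /e_vec liftK dotp_delta.
Qed.

(** Lift the supporting functional of F to a real element w of the dual cone that vanishes on the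
    lifts of F of height at most 1. Any element of the dual cone occurring in w with positive weight
    vanishes there too, so it suffices to split off a lattice element of degree 1. *)
Lemma face_monomial F : proper_face Q F ->
  exists w : 'rV[int]_(d + k.+1),
    [/\ in_dual (sigma_bar Delta_) w, ldeg w = 1
      & forall z, bidual z -> F (cayley_proj z) -> \sum_j rsubmx z 0 j <= 1 ->
          dotp z (realv R w) = 0].
Proof.
move=> [FQ [u [c [cu FE]]]].
have c_le0 : c <= 0 by have := cu _ cayley0; rewrite dotp0l.
have [dw hw] := cayley_supporting cu.
set alpha := (X in row_mx _ X) in dw hw; set w := row_mx _ alpha in dw hw.
(* Here <z, w> is c (1 - height of z), which is at most 0. *)
have wz z : bidual z -> F (cayley_proj z) -> \sum_j rsubmx z 0 j <= 1 ->
    dotp z w = 0.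
  move=> bz; rewrite FE => -[_ zu] z1; apply/le_anti.
  rewrite bidual_ge0 // andbT hw zu -{1}[c]mulr1 -mulrBr.
  by rewrite mulr_le0_ge0 ?subr_ge0.
(* If c were 0, then u would vanish and F would be all of Q. *)
have c_lt0 : c < 0.
  rewrite lt_neqAle c_le0 andbT; apply/eqP => c0; apply: FQ.
  have u0 : u = 0 by apply: cayley_nonneg_functional0 => x /cu; rewrite c0.
  rewrite FE; apply/seteqP; split=> [x []//|x Qx]; split=> //.
  by rewrite u0 c0 dotp0r.
have gen_ge0 j y : Delta_ j y -> 0 <= dotp y (lsubmx u) + alpha 0 j.
  by move: dw => /dual_sigma_barP/(_ j y); rewrite row_mxKl row_mxKr.
(* First case: w has a minimum e > 0 on the generators over Delta_j, so w - e r_j is still in the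
   dual cone. *)
have [[j hj]|no_j] := pselect (exists j, forall y, Delta_ j y ->
    0 < dotp y (lsubmx u) + alpha 0 j).
  have [v [hv minv]] := lattice_polytope_min (lsubmx u) (lat_Delta_ j)
    (summand_neq0 j).
  set e := dotp (realv R v) (lsubmx u) + alpha 0 j.
  have e0 : 0 < e by exact: hj.
  exists (r_vec d j); split; first exact: in_dual_r_vec.
    by rewrite ldegE /r_vec row_mxKr sum_delta.
  move=> z bz Fz z1; apply/le_anti; rewrite bidual_ge0 ?andbT //; last first.
    exact/asboolP/in_dual_r_vec.
  suff /(bidual_ge0 bz) : dual_cone (sigma_bar Delta_)
      (w - e *: realv R (r_vec d j)).
    by rewrite dotpDr dotpNr dotpZr wz // add0r oppr_ge0 pmulr_rle0.
  apply/dual_sigma_barP => i y hy.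
  have -> : lsubmx (w - e *: realv R (r_vec d j)) = lsubmx u.
    rewrite linearB linearZ /= row_mxKl /r_vec realv_row_mx row_mxKl.
    by rewrite /realv map_mx0 scaler0 subr0.
  have -> : rsubmx (w - e *: realv R (r_vec d j)) 0 i = alpha 0 i - e *+ (i == j).
    rewrite linearB linearZ /= row_mxKr /r_vec realv_row_mx row_mxKr.
    by rewrite /realv map_delta_mx mxE [in X in _ + X]mxE !mxE eqxx /= mulr_natr.
  have [ij|_] := eqVneq i j; last by rewrite mulr0n subr0 gen_ge0.
  by rewrite mulr1n addrA subr_ge0 ij lerD2r minv // -ij.
(* Second case: over each summand there is a generator (y_j, r_j) on which w vanishes. After
   division by gamma the first part of u is a point of the polar with value -1 at the sum of the
   y_j. *)
have /choice[y hy] : forall j, exists y, Delta_ j y /\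
    dotp y (lsubmx u) + alpha 0 j = 0.
  move=> j; apply: contrapT => h; apply: no_j; exists j => y hy.
  rewrite lt_neqAle gen_ge0 // andbT eq_sym; apply/eqP => e; apply: h.
  by exists y.
pose gamma := \sum_j alpha 0 j.
have gammaE : gamma = - c * k.+1%:R.
  rewrite /gamma; under eq_bigr do rewrite mxE.
  rewrite sumrB -dotp_suml sum_e_vec dotp0l sumr_const card_ord sub0r.
  by rewrite mulNr mulr_natr.
have gamma_gt0 : 0 < gamma by rewrite gammaE mulr_gt0 ?oppr_gt0.
have hy1 j : Delta_ j (y j) by have [] := hy j.
have yE j : dotp (y j) (lsubmx u) = - alpha 0 j.
  by apply/eqP; rewrite -addr_eq0; have [_ ->] := hy j.
have pol : polar Delta (gamma^-1 *: lsubmx u).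
  move=> _ [x [hx ->]]; rewrite dotpZr mulrC ler_pdivlMr // mulN1r dotp_suml.
  rewrite /gamma -sumrN; apply: ler_sum => j _.
  by rewrite -subr_ge0 opprK gen_ge0.
have yu : dotp (\sum_j y j) (gamma^-1 *: lsubmx u) = -1.
  rewrite dotpZr dotp_suml; under eq_bigr do rewrite yE.
  by rewrite sumrN mulrN mulVf ?gt_eqF.
have [N [l [n [l0 l1 uE ln]]]] := polar_decomposition hy1 pol yu.
(* The last coordinates agree because y_j attains the minimum on Delta_j of every n_i of nonzero
   weight. *)
have wE : w = gamma *: \sum_i l i *: realv R (base_pt (n i)).
  have uE' : lsubmx u = gamma *: \sum_i l i *: realv R (n i).
    by rewrite -uE scalerA divff ?gt_eqF // scale1r.
  rewrite -[RHS]hsubmxK !linearZ !linear_sum /=; congr row_mx.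
    rewrite [LHS]uE'; congr (_ *: _); apply: eq_bigr => i _.
    by rewrite linearZ /= /base_pt realv_row_mx row_mxKl.
  apply/rowP => j; rewrite [RHS]mxE summxE -[LHS]opprK -yE uE' dotpZr -mulrN.
  congr (_ * _); rewrite dotp_sumr -sumrN; apply: eq_bigr => i _.
  rewrite linearZ /= /base_pt realv_row_mx row_mxKr dotpZr !mxE rmorphN mulrN.
  have [->|/ln[_ ->]//] := eqVneq (l i) 0.
  by rewrite !mul0r.
have [i li] := exists_neq0_coeff l1.
exists (base_pt (n i)); split; first exact: in_dual_base_pt.
  rewrite ldegE /base_pt row_mxKr; under eq_bigr do rewrite mxE.
  by have [e _] := ln i li; rewrite sumrN e opprK.
move=> z bz Fz z1; move: (wz z bz Fz z1); rewrite wE dotpZr dotp_sumr => /eqP.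
rewrite mulf_eq0 gt_eqF //= => /eqP s0.
have {}s0 : \sum_a l a * dotp z (realv R (base_pt (n a))) = 0.
  by rewrite -[RHS]s0; apply: eq_bigr => a _; rewrite dotpZr.
have ge0 a : true -> 0 <= l a * dotp z (realv R (base_pt (n a))).
  by rewrite mulr_ge0 // bidual_ge0 //; exact/asboolP/in_dual_base_pt.
have /eqP := psumr_eq0P ge0 s0 (erefl : xpredT i).
by rewrite mulf_eq0 (negPf li) => /eqP.
Qed.

(** Adding the bound M to all coordinates of the second part makes them nonnegative without changing
    their shear. The remaining error x' in the first part is a multiple of a point of Delta, and the
    sum of the (y'_j, r_j) over that point has shear 0. *)
Lemma cayley_lift_exists x : exists2 z, bidual z & cayley_proj z = x.
Proof.
pose s := rsubmx x; pose M := \sum_i `|s 0 i|.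
pose delta : 'rV[R]_k.+1 :=
  \row_j (M + if unlift ord0 j is Some i then s 0 i else 0).
have delta_ge0 j : 0 <= delta 0 j.
  rewrite mxE; case: (unliftP ord0 j) => [i|] _; last first.
    by rewrite addr0 sumr_ge0.
  rewrite -lerBlDr sub0r /M (bigD1 i) //=.
  by rewrite ler_wpDr ?sumr_ge0 // -normrN ler_norm.
have sdelta : shear delta = s.
  apply/rowP => i.
  by rewrite !mxE liftK unlift_none addr0 addrAC subrr add0r /s mxE.
have /choice[y hy] := summand_neq0.
pose x' := lsubmx x - \sum_j delta 0 j *: y j.
have [_ D0 _] := refl_Delta.
have [t t0 [y' [hy' ty']]] := interior0_absorbing x' D0.
exists (\sum_j delta 0 j *: row_mx (y j) (delta_mx 0 j) +
        \sum_j t^-1 *: row_mx (y' j) (delta_mx 0 j)).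
  apply: bidualD; apply: bidual_sum => // j; last 2 first.
  - by rewrite invr_ge0 ltW.
  - exact: bidual_generator.
  exact: bidual_generator.
rewrite linearD !linear_sum /=.
under eq_bigr do rewrite linearZ /= cayley_proj_generator scale_row_mx.
under [X in _ + X]eq_bigr do rewrite linearZ /= cayley_proj_generator scale_row_mx.
have row_sum (f : 'I_k.+1 -> 'rV[R]_d) (g : 'I_k.+1 -> 'rV[R]_k) :
    \sum_j row_mx (f j) (g j) = row_mx (\sum_j f j) (\sum_j g j).
  by elim/big_rec3: _ => [|j ? ? ? _ ->]; rewrite ?row_mx0 ?add_row_mx.
rewrite !row_sum add_row_mx -!scaler_sumr -ty' sum_e_vec scaler0 addr0.
rewrite scalerA mulVf ?gt_eqF // scale1r addrC subrK.
rewrite -[RHS]hsubmxK; congr row_mx.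
rewrite -[RHS]sdelta [in RHS](row_sum_delta delta).
by rewrite linear_sum; apply: eq_bigr => j _; rewrite linearZ /= shear_delta.
Qed.

(* The support function of the divisor of zeros of chi^(r_0^* ). *)
Definition support_function (x : 'rV[R]_(d + k)) : R :=
  - inf [set rsubmx z 0 ord0 | z in [set z | bidual z /\ cayley_proj z = x]].

(** Lifts of x and y add up to a lift of x + y; all the infima are over nonempty sets bounded below
    by 0. *)
Lemma support_function_superadditive x y :
  support_function x + support_function y <= support_function (x + y).
Proof.
rewrite /support_function; set Ex := (X in - inf X + _).
set Ey := (X in _ - inf X <= _); set E := (X in _ <= - inf X).
have nE u : [set rsubmx z 0 ord0 | z in [set z | bidual z /\ cayley_proj z = u]]
    !=set0.
  have [z bz zu] := cayley_lift_exists u.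
  by exists (rsubmx z 0 ord0), z.
rewrite -opprD lerN2 -lerBlDr; apply: lb_le_inf; first exact: nE.
move=> _ [a [ba ax] <-]; rewrite lerBlDr -lerBlDl.
apply: lb_le_inf; first exact: nE.
move=> _ [b [bb by_] <-]; rewrite lerBlDl; apply: ge_inf.
  by exists 0 => _ [z [bz _] <-]; exact: bidual_first_ge0.
exists (a + b); last by rewrite linearD mxE.
by split; [exact: bidualD|rewrite linearD /= ax by_].
Qed.

(** Over a fixed projection, pairing with w and the first coordinate differ by a constant. Since w
    is nonnegative on all lifts and 0 at z, the infimum is attained at z. *)
Lemma support_function_face w z : in_dual (sigma_bar Delta_) w -> ldeg w = 1 ->
  bidual z -> dotp z (realv R w) = 0 ->
  support_function (cayley_proj z) = dotp (cayley_proj z) (realv R (drop_first w)) /\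
  support_function (cayley_proj z) = - rsubmx z 0 ord0.
Proof.
move=> /asboolP dw w1 bz zw.
have hE z' : dotp z' (realv R w) =
    dotp (cayley_proj z') (realv R (drop_first w)) + rsubmx z' 0 ord0.
  by rewrite dotp_cayley_proj sum_rsubmx_realv w1 mulr1 realv_drop_first.
have e : support_function (cayley_proj z) = - rsubmx z 0 ord0.
  congr (- _); apply: inf_attained; first by exists z.
  move=> _ [z' [bz' pz'] <-]; have := bidual_ge0 bz' dw.
  by rewrite -zw !hE pz' lerD2l.
by split => //; rewrite e; apply/eqP; rewrite eq_sym -addr_eq0 -hE zw.
Qed.

(** * Vertices of the Cayley polytope and the divisor class of degree 1 *)

Lemma realv_cayley_proj z : realv R (cayley_proj z) = cayley_proj (realv R z).
Proof.
rewrite /cayley_proj realv_row_mx; congr row_mx; apply/rowP => i; rewrite !mxE //.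
by rewrite rmorphB.
Qed.

(** An exposed point of the hull is a generator. It is not 0, since a supporting functional with
    minimum 0 is zero and exposes all of Q. *)
Lemma cayley_vertex v : vertex Q (realv R v) ->
  exists v' j, Delta_ j (realv R v') /\ v = row_mx v' (e_vec int j).
Proof.
move=> [FQ [u [c [cu FE]]]].
have [Qv vu] : Q (realv R v) /\ dotp (realv R v) u = c.
  by have : [set realv R v] (realv R v) by []; rewrite FE.
have sQ j y : tilde_polytope Delta_ j y -> Q y.
  by move=> hy; apply: sub_conv; exists j.
have [y [j _ ty] yu] : exists2 y, (\bigcup_i tilde_polytope Delta_ i) y &
    dotp y u = c.
  by apply: conv_exposed Qv vu => y [j _ /sQ]; exact: cu.
have [z hz zu] : exists2 z,
    ([set row_mx x (e_vec R j) | x in Delta_ j] `|` [set 0]) z & dotp z u = c.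
  by apply: conv_exposed ty yu => z hz; apply: cu; apply: (sQ j); exact: sub_conv.
have : [set realv R v] z.
  by rewrite FE; split => //; apply: (sQ j); exact: sub_conv.
move=> /= zv; case: hz => [[x hx xz]|z0].
  exists (lsubmx v), j; move: xz; rewrite zv -[v in realv R v]hsubmxK realv_row_mx.
  move=> /eq_row_mx[xv ev]; split; first by rewrite -xv.
  rewrite -[LHS]hsubmxK; congr row_mx; apply: (@realv_inj R).
  by rewrite -ev realv_e_vec.
have c0 : c = 0 by rewrite -zu z0 dotp0l.
have u0 : u = 0 by apply: cayley_nonneg_functional0 => x /cu; rewrite c0.
case: FQ; rewrite FE; apply/seteqP; split=> [x []//|x Qx]; split=> //.
by rewrite u0 c0 dotp0r.
Qed.

Lemma sigma_bar_lift_vertex v : vertex Q (realv R v) ->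
  [/\ bidual (realv R (sigma_bar_lift v)), cayley_proj (sigma_bar_lift v) = v
    & ldeg (sigma_bar_lift v) = 1].
Proof.
move=> /cayley_vertex[v' [j [hv' ->]]]; rewrite sigma_bar_liftE; split.
- by rewrite realv_row_mx /realv map_delta_mx; exact: bidual_generator.
- exact: cayley_proj_generator.
by rewrite ldegE row_mxKr sum_delta.
Qed.

Definition first_divisor : tdivisor (d + k) :=
  fun v => dotp (sigma_bar_lift v) (r_vec d ord0).

Lemma dotp_r_vec (z : 'rV[int]_(d + k.+1)) j : dotp z (r_vec d j) = rsubmx z 0 j.
Proof.
by rewrite -{1}[z]hsubmxK /r_vec dotp_row_mx dotp0r add0r dotp_deltar.
Qed.

(** On the cone over a face the support function is the linear function [drop_first w], for w from
    [face_monomial]; a vertex is treated as a face. *)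
Lemma nef_first_divisor : nef Q first_divisor.
Proof.
exists support_function; split; last exact: support_function_superadditive.
  move=> v vv; have [bz pz z1] := sigma_bar_lift_vertex vv.
  have [w [dw w1 hw]] := face_monomial vv.
  have pzR : cayley_proj (realv R (sigma_bar_lift v)) = realv R v.
    by rewrite -realv_cayley_proj pz.
  have z1R : \sum_j rsubmx (realv R (sigma_bar_lift v)) 0 j <= 1.
    by rewrite sum_rsubmx_realv z1.
  have zw : dotp (realv R (sigma_bar_lift v)) (realv R w) = 0.
    by apply: hw => //; rewrite pzR.
  have [_] := support_function_face dw w1 bz zw.
  by rewrite pzR => ->; rewrite /first_divisor dotp_r_vec !mxE.
move=> F pF; have [w [dw w1 hw]] := face_monomial pF.
exists (drop_first w) => t x t0 Fx.
have Qx : Q x by move: pF Fx => [_ [u [c [_ ->]]]] [].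
have [z [bz pz z1]] := cayley_lift Qx.
have <- : cayley_proj (t *: z) = t *: x by rewrite linearZ /= pz.
have btz : bidual (t *: z) by move=> y dy; rewrite dotpZr mulr_ge0 // bz.
have tzw : dotp (t *: z) (realv R w) = 0.
  by rewrite dotpZl hw ?mulr0 // pz.
by have [] := support_function_face dw w1 btz tzw.
Qed.

Lemma lin_equiv_degree1 w : ldeg w = 1 ->
  lin_equiv Q (fun v => dotp (sigma_bar_lift v) w) first_divisor.
Proof.
move=> w1; exists (drop_first w) => v /sigma_bar_lift_vertex[_ pv _].
rewrite dotp_cayley_proj pv -ldegE w1 mulr1 /first_divisor dotp_r_vec.
by rewrite addrK.
Qed.

Lemma ldeg_r_vec j : ldeg (r_vec d j : 'rV[int]_(d + k.+1)) = 1.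
Proof. by rewrite ldegE row_mxKr sum_delta. Qed.

(** The divisors of x_0, ..., x_k are all equivalent to [first_divisor], and they add up to 1 on
    each ray because vertices lift to degree 1. *)
Lemma lin_equiv_anticanonical :
  lin_equiv Q (fun v => \sum_(i < k.+1) first_divisor v) (@anticanonical _).
Proof.
exists (- \sum_i drop_first (r_vec d i)) => v vv.
have [_ pv v1] := sigma_bar_lift_vertex vv.
have e i : dotp v (drop_first (r_vec d i)) =
    dotp (sigma_bar_lift v) (r_vec d i) - first_divisor v.
  rewrite dotp_cayley_proj pv -ldegE ldeg_r_vec mulr1 /first_divisor dotp_r_vec.
  by rewrite addrK.
rewrite dotpNr dotp_sumr; under [in RHS]eq_bigr do rewrite e dotp_r_vec.
by rewrite sumrB -ldegE v1 opprB.
Qed.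

(** * The coordinate ring of the Cayley cone *)

Let S := dual_semigroup (sigma_bar Delta_).
Let A := cone_ring (sigma_bar Delta_).

Let base_elt n : S := DualSemigroup (in_dual_base_pt n).
Let r_elt j : S := DualSemigroup (in_dual_r_vec j).

Lemma mem_min_pairing_ge (w : S) j :
  - min_pairing (Delta_ j) (lsubmx (lattice_pt w)) <= rsubmx (lattice_pt w) 0 j.
Proof. by case: w => w /= /in_dual_sigma_barP. Qed.

(** The exponent beta_j of x_j in the decomposition over the basis monomials. *)
Let excess (w : S) j : nat :=
  absz (rsubmx (lattice_pt w) 0 j + min_pairing (Delta_ j) (lsubmx (lattice_pt w))).

Lemma excessE w j : (excess w j)%:Z =
  rsubmx (lattice_pt w) 0 j + min_pairing (Delta_ j) (lsubmx (lattice_pt w)).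
Proof.
by rewrite /excess gez0_abs // -lerBlDr sub0r mem_min_pairing_ge.
Qed.

Lemma base_decomposition (w : S) :
  w = base_elt (lsubmx (lattice_pt w)) + \sum_j r_elt j *+ excess w j.
Proof.
apply: val_inj; rewrite -[LHS]/(lattice_pt w) -[RHS]/(lattice_pt _).
rewrite lattice_ptD lattice_pt_sum.
under eq_bigr do rewrite lattice_ptMn.
have -> : \sum_j lattice_pt (r_elt j) *+ excess w j =
    row_mx 0 (\row_j (excess w j)%:Z).
  by rewrite -sum_scaled_r_vec; apply: eq_bigr => j _; rewrite -scaler_nat natz.
rewrite -{1}[lattice_pt w]hsubmxK [lattice_pt (base_elt _)]/= /base_pt.
rewrite add_row_mx addr0; congr row_mx; apply/rowP => j.
rewrite [RHS]mxE [X in _ = X + _]mxE [X in _ = _ + X]mxE excessE.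
by rewrite addrCA addNr addr0.
Qed.

Lemma monomial_decomposition (w : S) : monomial w =
  monomial (base_elt (lsubmx (lattice_pt w))) *
  \prod_j monomial (r_elt j) ^+ excess w j.
Proof. by rewrite {1}[w]base_decomposition -monomialM monomial_sum. Qed.

(* On monomials, this identifies x_0, ..., x_(m-1). *)
Definition merge (m : nat) (w : 'rV[int]_(d + k.+1)) : 'rV[int]_(d + k.+1) :=
  row_mx (lsubmx w) (\row_(j < k.+1)
    if j == ord0 then \sum_(i < k.+1 | (i < m)%N) rsubmx w 0 i
    else if (j < m)%N then 0 else rsubmx w 0 j).

Lemma mergeD m : {morph merge m : x y / x + y}.
Proof.
move=> x y; rewrite /merge add_row_mx linearD; congr row_mx.
apply/rowP => j; rewrite !mxE; case: ifP => _.
  by rewrite -big_split; apply: eq_bigr => i _; rewrite !mxE.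
by case: ifP => _; rewrite ?addr0 ?mxE.
Qed.

Lemma merge0 m : merge m 0 = 0.
Proof. by apply: (@addrI _ (merge m 0)); rewrite -mergeD !addr0. Qed.

Variable a : 'rV[int]_d -> R[i].
Let F := intersection_eq Delta_ a.
Let early m := [pred j : 'I_k.+1 | (j != ord0) && (j < m)%N].

Lemma intersection_eq_diff j : j != ord0 ->
  F j = monomial (r_elt j) - monomial (r_elt ord0).
Proof.
rewrite /F /intersection_eq => /negPf ->.
by rewrite (chiE (in_dual_r_vec j)) (chiE (in_dual_r_vec ord0)).
Qed.

(** Modulo the differences, each x_j with j < m may be replaced by x_0. What is left of a monomial
    depends only on its base point, the total exponent over j < m, and the other exponents, all of
    which [merge] determines. *)
Lemma merge_congruence m (w w' : S) : (0 < m)%N ->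
  merge m (lattice_pt w) = merge m (lattice_pt w') ->
  span (early m) F (monomial w - monomial w').
Proof.
move=> m0 /eq_row_mx[lE /rowP rE].
pose x j := monomial (r_elt j).
pose y (j : 'I_k.+1) := if (j < m)%N then x ord0 else x j.
have xy j : span (early m) F (x j - y j).
  rewrite /y; case: ifP => [jm|_]; last by rewrite subrr; exact: span0.
  have [->|j0] := eqVneq j ord0; first by rewrite subrr; exact: span0.
  by rewrite -intersection_eq_diff //; apply: span_gen; rewrite /= j0.
have yE (v : S) : \prod_j y j ^+ excess v j =
    x ord0 ^+ (\sum_(j < k.+1 | (j < m)%N) excess v j) *
    \prod_(j < k.+1 | ~~ (j < m)%N) x j ^+ excess v j.
  exact: prod_if_exp.
(* Since m > 0, an index outside the merged range is not 0, and [merge] keeps its coordinate. *)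
have eE (j : 'I_k.+1) : ~~ (j < m)%N -> excess w j = excess w' j.
  move=> jm; have := rE j; rewrite !mxE (negPf jm).
  case: eqP => [j0|_ e]; first by rewrite j0 m0 in jm.
  by rewrite /excess lE !mxE e.
have sE : (\sum_(j < k.+1 | (j < m)%N) excess w j =
            \sum_(j < k.+1 | (j < m)%N) excess w' j)%N.
  apply/eqP; rewrite -eqz_nat !(big_morph Posz PoszD (erefl _)); apply/eqP.
  under eq_bigr do rewrite excessE; under [RHS]eq_bigr do rewrite excessE.
  by rewrite !big_split /= lE; have := rE ord0; rewrite !mxE /= => ->.
have main (v : S) : span (early m) F
    (monomial v - monomial (base_elt (lsubmx (lattice_pt v))) *
     \prod_j y j ^+ excess v j).
  rewrite monomial_decomposition; apply: spanMB.
    by rewrite subrr; exact: span0.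
  exact: span_prodB.
have pE : \prod_j y j ^+ excess w j = \prod_j y j ^+ excess w' j.
  apply: etrans (yE w) _; apply: etrans _ (esym (yE w')).
  apply: (congr2 *%R); first exact: (congr1 (fun n => x ord0 ^+ n) sE).
  by apply: eq_bigr => j /eE e; exact: (congr1 (fun n => x j ^+ n) e).
have := main w; rewrite (congr1 base_elt lE) pE => main_w.
have := spanD main_w (spanM (-1) (main w')).
set p := monomial w; set q := monomial w'; set r := _ * _.
by rewrite mulN1r opprB addrA subrK.
Qed.

Definition merge_hom (m : nat) : A -> sgring R[i] 'rV[int]_(d + k.+1) :=
  sgmap (fun w : S => merge m (lattice_pt w)).

HB.instance Definition _ m := GRing.Linear.on (merge_hom m).

Fact merge_hom_is_monoid_morphism m : monoid_morphism (merge_hom m).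
Proof.
split; first by apply: sgmap1; rewrite lattice_pt0 merge0.
by apply: sgmapM => u v; rewrite lattice_ptD mergeD.
Qed.

HB.instance Definition _ m := GRing.isMonoidMorphism.Build A
  (sgring R[i] 'rV[int]_(d + k.+1)) (merge_hom m)
  (merge_hom_is_monoid_morphism m).

Lemma merge_hom_monomial m w :
  merge_hom m (monomial w) = << merge m (lattice_pt w) >>.
Proof. exact: sgmapU. Qed.

Lemma merge_hom_diff m u v : merge_hom m (monomial u - monomial v) =
  << merge m (lattice_pt u) >> - << merge m (lattice_pt v) >>.
Proof.
apply: etrans (rmorphB (merge_hom m) (monomial u) (monomial v)) _.
by apply: (congr2 (fun x y => x - y)); exact: merge_hom_monomial.
Qed.

Lemma merge_hom_kernel m f : (0 < m)%N -> merge_hom m f = 0 ->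
  span (early m) F f.
Proof.
move=> m0; apply: sgmap_kernel.
- exact: span0.
- exact: spanD.
- by move=> x y; exact: spanM.
- by move=> u v; exact: merge_congruence.
Qed.

Lemma merge_r_vec m j : j != ord0 ->
  merge m (r_vec d j) = if (j < m)%N then r_vec d ord0 else r_vec d j.
Proof.
move=> j0; rewrite /merge /r_vec row_mxKl.
have -> : (if (j < m)%N then row_mx 0 (delta_mx 0 ord0) else row_mx 0 (delta_mx 0 j))
    = row_mx 0 (delta_mx 0 (if (j < m)%N then ord0 else j)) :> 'rV[int]_(d + k.+1).
  by case: ifP.
congr row_mx; apply/rowP => i; rewrite row_mxKr !mxE /=.
have [->|i0] := eqVneq i ord0.
  have [jm|jm] := boolP (j < m)%N; last first.
    rewrite [RHS](_ : _ = 0); last by rewrite eq_sym (negPf j0).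
    rewrite big1 // => l lm; rewrite mxE eqxx /=; case: eqP => // lj.
    by rewrite lj (negPf jm) in lm.
  rewrite (bigD1 j) //= mxE !eqxx big1 // => l /andP[_ /negPf lj].
  by rewrite mxE lj andbF.
have [jm|jm] := boolP (j < m)%N.
  rewrite (negPf i0); case: ifP => // im; case: eqP => // ij.
  by rewrite ij jm in im.
case: ifP => [im|_] //.
by case: eqP => // ij; rewrite -ij im in jm.
Qed.

Lemma merge_r_vec0 m : (0 < m)%N -> merge m (r_vec d ord0) = r_vec d ord0.
Proof.
move=> m0; rewrite /merge /r_vec row_mxKl; congr row_mx; apply/rowP => i.
rewrite row_mxKr !mxE /=; have [_|i0] := eqVneq i ord0.
  rewrite (bigD1 ord0) //= mxE !eqxx big1 // => l /andP[_ /negPf l0].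
  by rewrite mxE l0 andbF.
by rewrite if_same.
Qed.

Lemma merge_hom_early m j : early m j -> merge_hom m (F j) = 0.
Proof.
move=> /andP[j0 jm]; rewrite (intersection_eq_diff j0).
apply: etrans (merge_hom_diff m _ _) _.
rewrite /r_elt [lattice_pt _]/= [lattice_pt (DualSemigroup _)]/=.
rewrite merge_r_vec // jm merge_r_vec0 ?subrr //.
exact: leq_ltn_trans jm.
Qed.

(** [merge j] identifies only the indices below j, so r_j stays distinct from r_0. *)
Lemma merge_hom_late j : j != ord0 -> merge_hom j (F j) <> 0.
Proof.
move=> j0; rewrite (intersection_eq_diff j0) => Fj0.
have := etrans (esym (merge_hom_diff j _ _)) Fj0.
rewrite /r_elt [lattice_pt _]/= [lattice_pt (DualSemigroup _)]/=.
rewrite merge_r_vec // ltnn merge_r_vec0 ?lt0n //.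
move=> /malgP/(_ (r_vec d j))/eqP; rewrite mcoeffB mcoeffUU mcoeffU mcoeff0.
have [/eq_row_mx[_ /rowP/(_ j)] + _|_] := eqVneq (r_vec d ord0) (r_vec d j);
  last by rewrite subr0 oner_eq0.
by rewrite !mxE !eqxx (negPf j0).
Qed.

(** * The restriction homomorphism *)

Let A' := cone_ring (sigma Delta).

HB.instance Definition _ := GRing.Linear.on (restriction (Delta_ := Delta_)).

Lemma ldeg_sum_last (w : 'rV[int]_(d + k.+1)) : ldeg (sum_last w) = ldeg w.
Proof. by rewrite {1}/ldeg big_ord1 /sum_last row_mxEr mxE. Qed.

Lemma sum_lastD : {morph @sum_last d k : x y / x + y}.
Proof.
move=> x y; rewrite /sum_last linearD add_row_mx; congr row_mx.
apply/rowP => i; rewrite !mxE !ldegE -big_split; apply: eq_bigr => j _.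
by rewrite linearD mxE.
Qed.

Lemma sum_last_semigroupD :
  {morph @sum_last_semigroup R d k Delta_ : u v / u + v}.
Proof.
move=> u v; apply: val_inj; rewrite -[LHS]/(sum_last (lattice_pt (u + v))).
by rewrite -[RHS]/(lattice_pt (_ + _)) !lattice_ptD sum_lastD.
Qed.

Lemma sum_last_semigroup0 : @sum_last_semigroup R d k Delta_ 0 = 0.
Proof.
apply: val_inj; rewrite -[LHS]/(sum_last (lattice_pt (0 : S))).
rewrite -[RHS]/(lattice_pt 0) !lattice_pt0.
by apply: (@addrI _ (@sum_last d k 0)); rewrite -sum_lastD !addr0.
Qed.

Fact restriction_is_monoid_morphism :
  monoid_morphism (restriction (Delta_ := Delta_)).
Proof.
split; first exact: (sgmap1 _ sum_last_semigroup0).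
by apply: sgmapM => u v; exact: sum_last_semigroupD.
Qed.

HB.instance Definition _ := GRing.isMonoidMorphism.Build A A'
  (restriction (Delta_ := Delta_)) restriction_is_monoid_morphism.

Lemma restriction_monomial (w : S) :
  restriction (monomial w) = monomial (sum_last_semigroup w).
Proof. exact: sgmapU. Qed.

(** Points with the same image under [sum_last] also agree after merging all k + 1 indices. *)
Lemma restriction_kernel f : restriction f = 0 ->
  span (fun j => j != ord0) F f.
Proof.
apply: sgmap_kernel.
- exact: span0.
- exact: spanD.
- by move=> x y; exact: spanM.
move=> u v /(congr1 (@lattice_pt _ _ _)) /= /eq_row_mx[lE /rowP/(_ ord0)].
rewrite !mxE !ldegE => dE.
have sub : span (early k.+1) F (monomial u - monomial v).
  apply: merge_congruence => //; rewrite /merge lE; congr row_mx.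
  apply/rowP => j; rewrite !mxE ltn_ord.
  under eq_bigl do rewrite ltn_ord.
  by under [in RHS]eq_bigl do rewrite ltn_ord; rewrite dE.
by apply: subset_span sub => j /andP[].
Qed.

Lemma restriction_diff j : j != ord0 -> restriction (F j) = 0.
Proof.
move=> j0; rewrite (intersection_eq_diff j0).
apply: etrans (rmorphB (restriction (Delta_ := Delta_)) _ _) _.
apply/eqP; rewrite subr_eq0; apply/eqP.
apply: etrans (restriction_monomial _) _.
apply: etrans _ (esym (restriction_monomial _)).
congr monomial; apply: val_inj => /=.
by rewrite /sum_last !ldeg_r_vec /r_vec !row_mxKl.
Qed.

Lemma in_dual_sigma_polar n : lattice_points (polar Delta) n ->
  in_dual (sigma Delta) (row_mx n (const_mx 1)).
Proof.
move=> pn; apply/asboolP => _ [t [x [t0 Dx ->]]].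
rewrite realv_row_mx dotp_row_mx dotpZl [X in _ + X]dotpE big_ord1 !mxE rmorph1.
by rewrite -mulrDr mulr_ge0 // -lerBlDr sub0r; exact: pn.
Qed.

Lemma intersection_exponentE n :
  row_mx n 0 - \sum_j min_pairing (Delta_ j) n *: r_vec d j = base_pt n.
Proof.
rewrite sum_scaled_r_vec opp_row_mx add_row_mx oppr0 addr0 add0r; congr row_mx.
by apply/rowP => j; rewrite !mxE.
Qed.

Lemma sum_last_base_pt n : lattice_points (polar Delta) n -> n != 0 ->
  sum_last (base_pt n) = row_mx n (const_mx 1).
Proof.
move=> pn n0; rewrite /sum_last row_mxKl; congr row_mx; apply/rowP => i.
rewrite !mxE ldegE row_mxKr; under eq_bigr do rewrite mxE.
by rewrite sumrN sum_min_pairing // opprK.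
Qed.

Lemma sum_last_r_vec j : sum_last (r_vec d j : 'rV[int]_(d + k.+1)) =
  row_mx 0 (const_mx 1).
Proof. by rewrite /sum_last row_mxKl ldeg_r_vec. Qed.

(** * The equations of the hypersurface and of its image *)

Hypothesis f_neq0 : hypersurface_eq Delta_ a != 0.

Lemma polar0 : lattice_points (polar Delta) 0.
Proof.
by move=> x _; rewrite /realv map_mx0 dotp0r lerN10.
Qed.

(* A sum over a set with infinitely many nonzero terms is 0 by convention. *)
Lemma finite_coefficients : exists E : {fset 'rV[int]_d},
  [/\ 0 \in E, forall n, n \in E -> lattice_points (polar Delta) n
    & forall n, lattice_points (polar Delta) n -> n \notin E -> a n = 0].
Proof.
pose g n := a n *: chi (sigma Delta) (row_mx n (const_mx 1)).
have fin : finite_set (lattice_points (polar Delta) `&` g @^-1` [set~ 0]).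
  apply: contrapT => inf; case/eqP: f_neq0.
  exact: (fsbig_dflt +%R inf).
exists (0 |` fset_set (lattice_points (polar Delta) `&` g @^-1` [set~ 0]))%fset.
split=> [|n|n pn].
- by rewrite in_fset1U eqxx.
- rewrite in_fset1U => /orP[/eqP ->|]; first exact: polar0.
  by rewrite in_fset_set // inE => -[].
rewrite in_fset1U negb_or in_fset_set // => /andP[_].
rewrite notin_setE => h; apply: contrapT => an; apply: h; split=> //.
move=> gn; apply: an; move: gn.
rewrite /= /g (chiE (in_dual_sigma_polar pn)).
move=> /malgP/(_ (DualSemigroup (in_dual_sigma_polar pn))).
by rewrite sgcoeffZ mcoeffUU mulr1 mcoeff0.
Qed.

(** Both sums are reduced to one finite list. The point 0 is split off because it corresponds to
    r_0, whereas [base_pt 0] has degree 0. *)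
Lemma equations_finite : exists E : seq 'rV[int]_d,
  [/\ 0 \notin E, forall n, n \in E -> lattice_points (polar Delta) n,
      hypersurface_eq Delta_ a = a 0 *: chi (sigma Delta) (row_mx 0 (const_mx 1)) +
        \sum_(n <- E) a n *: chi (sigma Delta) (row_mx n (const_mx 1))
    & F ord0 = a 0 *: chi (sigma_bar Delta_) (r_vec d ord0) +
        \sum_(n <- E) a n *: chi (sigma_bar Delta_) (base_pt n)].
Proof.
have [E [E0 pE aE]] := finite_coefficients.
have EP : [set` E] `<=` lattice_points (polar Delta) by move=> n; exact: pE.
have EsE : fset_set ([set` E] `\ 0) = (E `\ 0)%fset.
  by rewrite fset_setD1 // set_fsetK.
exists (E `\ 0)%fset; split.
- by rewrite in_fsetD1 eqxx.
- by move=> n; rewrite in_fsetD1 => /andP[_ /pE].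
- rewrite /hypersurface_eq -(fsbig_widen [set` E]) //; last first.
    by move=> n [pn /negP nE]; rewrite /= aE // scale0r.
  rewrite (fsbigD1 0) //=; congr (_ + _).
  rewrite fsbig_finite; last exact: finite_setD.
  by rewrite EsE.
rewrite /F /intersection_eq.
rewrite [ord0 == ord0]eqxx.
apply: (congr1 (fun y => a 0 *: chi (sigma_bar Delta_) (r_vec d ord0) + y)).
rewrite -(fsbig_widen ([set` E] `\ 0)); last 2 first.
- by move=> n [/EP pn n0].
- move=> n [[pn n0] nE]; rewrite /= aE ?scale0r //; apply/negP => En.
  exact: nE.
rewrite fsbig_finite; last exact: finite_setD.
rewrite EsE; apply: eq_bigr => n _.
by rewrite intersection_exponentE.
Qed.

Lemma restrictionZ c (x : A) : restriction (c *: x) = c *: restriction x.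
Proof. exact: linearZ_LR. Qed.

Lemma restriction_intersection_eq0 :
  restriction (F ord0) = hypersurface_eq Delta_ a.
Proof.
have [E [E0 pE -> ->]] := equations_finite.
apply: etrans (raddfD (restriction (Delta_ := Delta_)) _ _) _.
apply: (congr2 +%R).
  rewrite (chiE (in_dual_r_vec ord0)).
  apply: etrans (restrictionZ _ _) _.
  apply: (congr1 ( *:%R (a 0))); apply: etrans (restriction_monomial _) _.
  rewrite (chiE (in_dual_sigma_polar polar0)).
  by apply: (congr1 (@monomial _ _ _)); apply: val_inj; exact: sum_last_r_vec.
apply: etrans (raddf_sum (restriction (Delta_ := Delta_)) _ _ _) _.
apply: eq_big_seq => n nE.
have n0 : n != 0 by apply: contraNneq E0 => <-.
apply: etrans (restrictionZ _ _) _.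
apply: (congr1 ( *:%R (a n))); rewrite (chiE (in_dual_base_pt n)).
apply: etrans (restriction_monomial _) _.
rewrite (chiE (in_dual_sigma_polar (pE n nE))).
apply: (congr1 (@monomial _ _ _)); apply: val_inj.
exact: sum_last_base_pt (pE n nE) n0.
Qed.

Lemma intersection_eq_gr j : cone_gr 1 (F j).
Proof.
have gr_r i : cone_gr 1 (chi (sigma_bar Delta_) (r_vec d i)).
  by rewrite -(ldeg_r_vec i); exact: cone_gr_chi.
have [->|j0] := eqVneq j ord0; last first.
  rewrite /F /intersection_eq (negPf j0); apply: cone_grD => //.
  by rewrite -scaleN1r; exact: cone_grZ.
have [E [E0 pE _ ->]] := equations_finite.
apply: cone_grD; first exact: cone_grZ.
apply: cone_gr_sum => n nE; apply: cone_grZ.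
have <- : ldeg (base_pt n) = 1; last exact: cone_gr_chi.
have n0 : n != 0 by apply: contraNneq E0 => <-.
rewrite -ldeg_sum_last (sum_last_base_pt (pE n nE) n0).
by rewrite /ldeg big_ord1 row_mxEr mxE.
Qed.

(** Evaluate u at height 1 on the sum of the minimisers in the Delta_j. *)
Lemma sigma_dual_ge (u : dual_semigroup (sigma Delta)) :
  0 <= ldeg (lattice_pt u) + \sum_j min_pairing (Delta_ j) (lsubmx (lattice_pt u)).
Proof.
case: u => u /= /asboolP hu.
have /choice[v hv] := fun j => min_pairing_attained j (lsubmx u).
have : 0 <= dotp (row_mx (1 *: \sum_j realv R (v j)) (const_mx 1)) (realv R u).
  apply: hu; exists 1, (\sum_j realv R (v j)); split => //.
  by exists (fun j => realv R (v j)); split => // j; have [] := hv j.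
rewrite -{1}[u]hsubmxK realv_row_mx dotp_row_mx scale1r dotp_suml.
have -> : \sum_j dotp (realv R (v j)) (realv R (lsubmx u)) =
    (\sum_j min_pairing (Delta_ j) (lsubmx u))%:~R.
  rewrite rmorph_sum; apply: eq_bigr => j _.
  by have [_ ->] := hv j; rewrite dotp_realv.
rewrite dotpE big_ord1 !mxE mul1r -intrD ler0z addrC.
by rewrite {1}/ldeg big_ord1.
Qed.

Lemma ldeg_ge0 (u : dual_semigroup (sigma Delta)) : 0 <= ldeg (lattice_pt u).
Proof.
case: u => u /= /asboolP hu.
have := hu (row_mx (1 *: 0) (const_mx 1)); rewrite -{1}[u]hsubmxK realv_row_mx.
rewrite dotp_row_mx scaler0 dotp0l add0r dotpE big_ord1 !mxE mul1r ler0z.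
rewrite /ldeg big_ord1; apply.
by exists 1, 0; rewrite ler01 scaler0; split => //; exact: minkowski_sum0.
Qed.

Lemma sum_last_semigroup_surjective (u : dual_semigroup (sigma Delta)) :
  exists w : S, sum_last_semigroup w = u.
Proof.
set n := lsubmx (lattice_pt u).
pose b := absz (ldeg (lattice_pt u) + \sum_j min_pairing (Delta_ j) n).
(* The base point over n has degree at most that of u; the missing degree b is supplied by r_0. *)
exists (base_elt n + r_elt ord0 *+ b); apply: val_inj.
rewrite -[LHS]/(sum_last (lattice_pt (_ + _))) -[RHS]/(lattice_pt u).
rewrite lattice_ptD lattice_ptMn /= -[RHS]hsubmxK /sum_last; congr row_mx.
  by rewrite linearD linearMn /= /base_pt /r_vec !row_mxKl mul0rn addr0.
apply/rowP => i; rewrite [LHS]mxE ldegE.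
have -> : \sum_j rsubmx (base_pt n + r_vec d ord0 *+ b) 0 j =
    ldeg (lattice_pt u).
  rewrite linearD linearMn /= /base_pt /r_vec !row_mxKr.
  under eq_bigr do rewrite mxE.
  rewrite big_split /=; under eq_bigr do rewrite mxE.
  rewrite sumrN [X in _ + X](bigD1 ord0) //=.
  rewrite [X in _ + (_ + X)]big1 => [|j /negPf j0]; last first.
    by rewrite mulmxnE mxE j0 andbF mul0rn.
  rewrite mulmxnE mxE !eqxx addr0 /= mulr1n natz /b gez0_abs ?sigma_dual_ge //.
  by rewrite addrCA addNr addr0.
by rewrite /ldeg big_ord1 mxE (ord1 i).
Qed.

Lemma restriction_lift (y : A') : exists x : A, restriction x = y /\
  forall e, cone_gr e y -> cone_gr e x.
Proof.
have /choice[s hs] := sum_last_semigroup_surjective.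
exists (\sum_(u <- msupp y) y@_u *: monomial (s u)); split.
  apply: etrans (raddf_sum (restriction (Delta_ := Delta_)) _ _ _) _.
  rewrite [RHS]sgringE; apply: eq_bigr => u _.
  apply: etrans (restrictionZ _ _) _; apply: (congr1 ( *:%R _)).
  by apply: etrans (restriction_monomial _) _; rewrite hs.
move=> e ye; apply: cone_gr_sum => u uy; apply: cone_grZ.
move=> w /(fsubsetP msuppU_le); rewrite in_fset1 => /eqP ->.
by rewrite -ldeg_sum_last -(ye u uy) -[in RHS](hs u).
Qed.

Lemma restriction_gr e (x : A) : cone_gr e x -> cone_gr e (restriction x).
Proof.
move=> xe; rewrite [x]sgringE.
have -> : restriction (\sum_(u <- msupp x) x@_u *: monomial u) =
    \sum_(u <- msupp x) x@_u *: monomial (sum_last_semigroup u).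
  apply: etrans (raddf_sum (restriction (Delta_ := Delta_)) _ _ _) _.
  apply: eq_bigr => u _; apply: etrans (restrictionZ _ _) _.
  by rewrite restriction_monomial.
apply: cone_gr_sum => u ux; apply: cone_grZ.
move=> w /(fsubsetP msuppU_le); rewrite in_fset1 => /eqP ->.
by rewrite -(xe u ux) -ldeg_sum_last.
Qed.

Lemma restriction_component e (x : A) :
  restriction (component e x) = component e (restriction x).
Proof.
pose f1 := [eta restriction (Delta_ := Delta_)] \o component e.
pose f2 := component e \o [eta restriction (Delta_ := Delta_)].
have lin1 : linear (f1 : A -> A').
  by move=> c u v; rewrite /f1 /= !linearP.
have lin2 : linear (f2 : A -> A').
  by move=> c u v; rewrite /f2 /= !linearP.
apply: (linext_eq lin1 lin2) => u; rewrite /f1 /f2 /=.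
have -> : component e (<< u >> : sgring R[i] S) =
    if ldeg (lattice_pt u) == e then monomial u else 0 :> A.
  exact: linextU.
have -> : restriction (<< u >> : sgring R[i] S) = monomial (sum_last_semigroup u).
  exact: restriction_monomial.
have -> : component e (monomial (sum_last_semigroup u)) =
    if ldeg (sum_last (lattice_pt u)) == e then monomial (sum_last_semigroup u)
    else 0.
  exact: linextU.
rewrite ldeg_sum_last; case: ifP => _; first exact: restriction_monomial.
exact: raddf0.
Qed.

Lemma hypersurface_eq_gr : cone_gr 1 (hypersurface_eq Delta_ a).
Proof.
have := restriction_gr (@intersection_eq_gr ord0).
by rewrite restriction_intersection_eq0.
Qed.

(* The equation has degree 1 and the coordinate ring lives in degrees >= 0. *)
Lemma hypersurface_eq_not_unit c : 1 <> c * hypersurface_eq Delta_ a.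
Proof.
move=> /malgP/(_ 0); rewrite sgcoeffM sgring1E mcoeffUU big1_seq => [|u _].
  by move=> /eqP; rewrite oner_eq0.
rewrite big1_seq // => v /= vf.
case: eqP => [uv|_]; last by rewrite mulr0n.
have /eqP := congr1 (fun w => ldeg (lattice_pt w)) uv.
rewrite lattice_ptD lattice_pt0 ldegD (hypersurface_eq_gr vf).
rewrite [X in _ == X](_ : _ = 0); last by rewrite /ldeg big_ord1 mxE.
by rewrite gt_eqF // ltr_wpDl // ldeg_ge0.
Qed.

Lemma intersection_idealE (x : A) :
  ideal_of F x <->
  ideal_of (fun _ : 'I_1 => hypersurface_eq Delta_ a) (restriction x).
Proof.
apply: ideal_of_preimage.
- by move=> y; have [z [zy _]] := restriction_lift y; exists z.
- exact: restriction_kernel.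
- exact: restriction_intersection_eq0.
- exact: restriction_diff.
Qed.

Lemma intersection_eq_regular : regular_sequence F.
Proof.
split=> [i x|]; last first.
  move=> /intersection_idealE[c]; rewrite big_ord1 rmorph1.
  exact: hypersurface_eq_not_unit.
apply: (regular_of_kernels (phi := fun m => merge_hom m)).
- exact: sgring_domain.
- exact: merge_hom_kernel.
- exact: merge_hom_early.
(* Otherwise F_0 would be a combination of the differences, and its restriction, the equation of the
   hypersurface, would be 0. *)
- move=> m m0 /(merge_hom_kernel m0)[c F0]; case/eqP: f_neq0.
  rewrite -restriction_intersection_eq0 F0 rmorph_sum big1 // => j /andP[j0 _].
  by rewrite rmorphM /= restriction_diff // mulr0.
- exact: merge_hom_late.
Qed.

Lemma intersection_is_image :
  is_image (cone_gr (tau := sigma Delta)) (cone_gr (tau := sigma_bar Delta_))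
    (restriction (Delta_ := Delta_))
    (ideal_of (fun _ : 'I_1 => hypersurface_eq Delta_ a)) (ideal_of F).
Proof.
apply: (is_image_preimage (compB := fun e => component e)
  (compA := fun e => component e)).
- by move=> e s; exact: raddf_sum.
- by move=> e e' y; exact: component_gr.
- by move=> e x; exact: component_homogeneous.
- exact: component_sum.
- exact: restriction_component.
- exact: restriction_gr.
- exact: restriction_lift.
- exact: intersection_idealE.
by exists (fun=> 0); rewrite big1 // => i _; rewrite mul0r.
Qed.

Lemma intersection_nef_CY :
  nef_CY_complete_intersection Q (@sigma_bar_lift d k) F.
Proof.
split; first exact: intersection_eq_regular.
(* Every equation has degree 1, so the same divisor serves for all k + 1 of them. *)
exists (fun=> first_divisor); split; last exact: lin_equiv_anticanonical.
move=> i; split; last exact: nef_first_divisor.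
split; last by move=> w wF; apply: lin_equiv_degree1; exact: (intersection_eq_gr wF).
  apply/eqP; have [->|i0] := eqVneq i ord0.
    move=> F0; case/eqP: f_neq0; rewrite -restriction_intersection_eq0 F0.
    exact: raddf0.
  by move=> Fi0; case: (merge_hom_late i0); rewrite Fi0; exact: raddf0.
by exists 1; exact: intersection_eq_gr.
Qed.

End ReflexiveSum.

Theorem theorem4p1 (R : realType) (d k : nat)
    (Delta_ : 'I_k.+1 -> set 'rV[R]_d) (a : 'rV[int]_d -> R[i]) :
  (forall j, lattice_polytope (Delta_ j)) ->
  reflexive_polytope (minkowski_sum Delta_) ->
  CY_hypersurface (minkowski_sum Delta_) (@sigma_lift d)
    (hypersurface_eq Delta_ a) ->
  is_image (cone_gr (tau := sigma (minkowski_sum Delta_)))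
    (cone_gr (tau := sigma_bar Delta_)) (restriction (Delta_ := Delta_))
    (ideal_of (fun _ : 'I_1 => hypersurface_eq Delta_ a))
    (ideal_of (intersection_eq Delta_ a)) /\
  nef_CY_complete_intersection (cayley_polytope Delta_) (@sigma_bar_lift d k)
    (intersection_eq Delta_ a).
Proof.
move=> lat refl [f_neq0 _ _]; split.
  exact: intersection_is_image.
exact: intersection_nef_CY.
Qed.
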